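(* Let $k=k^\star+1$. Assume that conditions (A1), (A2), (O1)($k$), (O2)($k$) and (O3), all written out in the context, are satisfied with $D_2(k^\star)<D_1(k)$. Let $n_0$, $\delta_0$, $C_1$, $s>0$ and $\delta_{k,n}$ ($n\ge2$) be as defined in the context. Assume in addition that for all integers $n\ge n_0$ such that $\delta_{k,n}<\delta_0$ and for every positive integer $j\le\lfloor\delta_0/\delta_{k,n}\rfloor$, $$\mathcal E\Big(\mathcal F_n^k\cap\big[S_k(2(j+1)\delta_{k,n})\setminus S_k(2j\delta_{k,n})\big],\frac{j\delta_{k,n}}4\Big)\le\frac{s}{1+s}\cdot\frac{nj\delta_{k,n}}{64(C_1+2)\log^2(j\delta_{k,n})}.$$ Then there exists $c_3>0$ such that, for all $n\ge n_0$, $$P^{\star n}\{\widehat k_n^{\mathrm L}>k^\star\}\le c_3\,\frac{(\log n)^{3D_1(k^\star+1)/2+\beta_2}}{n^{[D_1(k^\star+1)-D_2(k^\star)]/2}}.$$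
   Context: Model. $Z_1,\dots,Z_n$ are i.i.d. random variables with values in a measured space $(\mathcal Z,\mathcal F,\mu)$; $Z^n=(Z_1,\dots,Z_n)$. $(\Theta_k)_{k\ge1}$ is an increasing family of nested finite-dimensional parameter sets, $d$ is the Euclidean distance on each, $\Theta_\infty=\bigcup_{k\ge1}\Theta_k$, $\Theta_0=\varnothing$. For $\theta\in\Theta_\infty$, $f_\theta$ is the density with respect to $\mu$ of a probability measure $P_\theta$, and $\ell_\theta=\log f_\theta$. The common law of the $Z_i$ is $P^\star=P_{\theta^\star}$, with density $f^\star=f_{\theta^\star}$, $\ell^\star=\log f^\star$, where $\theta^\star\in\Theta_{k^\star}\setminus\Theta_{k^\star-1}$; the integer $k^\star$ is the order of $P^\star$, i.e. the unique $k$ such that $P^\star\in\{P_\theta:\theta\in\Theta_k\setminus\Theta_{k-1}\}$. $P^{\star n}$ is the $n$-fold product of $P^\star$. Standing assumptions: for every $k\ge1$, $(\Theta_k,d)$ is compact and $\theta\mapsto\ell_\theta(z)$ is continuous from $\Theta_k$ to $\mathbb R$ for every $z\in\mathcal Z$. Prior and estimator. $\Pi$ is a prior on $\Theta_\infty$ of the form $d\Pi(\theta)=\pi(k)\pi_k(\theta)\,d\theta$ for $\theta\in\Theta_k$, $k\ge1$ ($\pi$ is a probability on the orders, $\pi_k$ a probability density on $\Theta_k$; $\pi_k$ also denotes the associated probability measure). $\Pi(k|Z^n)$ is the posterior probability of $k$, and $\widehat k_n^{\mathrm L}=\inf\{k\ge1:\Pi(k|Z^n)\ge\Pi(k+1|Z^n)\}$.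 Notation. $\lambda f$ denotes $\int f\,d\lambda$; $a\vee b=\max(a,b)$; $\lfloor a\rfloor$ is the largest integer strictly smaller than $a$. $L^1_+(\mu)$ is the set of nonnegative functions in $L^1(\mu)$; for $f\in L_+^1(\mu)$, $P_f$ is the measure with derivative $f$ with respect to $\mu$; $V(f,f')=P_f(\log f-\log f')^2$ (possibly $\infty$). $H(\theta)=P^\star(\ell^\star-\ell_\theta)$ is the Kullback–Leibler divergence ($\infty$ if $P^\star\not\ll P_\theta$). For $k\ge1$, $\delta>0$, $t\in\Theta_k$: $l_{t,\delta}=\inf\{f_{\theta'}:\theta'\in\Theta_k,d(t,\theta')<\delta\}$, $u_{t,\delta}=\sup\{f_{\theta'}:\theta'\in\Theta_k,d(t,\theta')<\delta\}$ (pointwise), $H_k^\star=\inf\{H(\theta'):\theta'\in\Theta_k\}$ (equal to $0$ for $k\ge k^\star$ and positive otherwise), $S_k(\delta)=\{\theta'\in\Theta_k:H(\theta')\le H_k^\star+\delta/2\}$. For $\alpha>0$, $q(\theta,\alpha)=P^\star\big[(\ell^\star-\ell_\theta)^2e^{\alpha(\ell^\star-\ell_\theta)}\big]+V(f^\star,f_\theta)\in[0,\infty]$. $\ell_n(\theta)=\sum_{i=1}^n\ell_\theta(Z_i)$, $\ell_n^\star=\sum_{i=1}^n\ell^\star(Z_i)$, $\mathbb B_n(k)=\pi(k)\int_{\Theta_k}e^{\ell_n(\theta)-\ell_n^\star}\,d\pi_k(\theta)$. Bracketing entropy. For functions $l\le u$, the bracket $[l,u]$ is the set of functions $f$ with $l\le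 f\le u$. It is a $\delta$-bracket if $l,u\in L_+^1(\mu)$, $\mu(u-l)\le\delta$, $P^\star(\log u-\log l)^2\le\delta^2$, $P_{u-l}(\log u-\log f^\star)^2\le\delta\log^2\delta$ and $P_l(\log u-\log l)^2\le\delta\log^2\delta$. For a class $\mathcal C$ of functions, $\mathcal E(\mathcal C,\delta)$ is the logarithm of the minimum number of $\delta$-brackets needed to cover $\mathcal C$; for a set of parameters $T$, $\mathcal E(T,\delta)$ means $\mathcal E(\{f_\theta:\theta\in T\},\delta)$. Conditions (with $K=k^\star+1$). (A1) For each $k\ge1$ there exist $\alpha,\bar\delta>0$, $M\ge1$ such that, for all $\delta\in(0,\bar\delta]$, $\sup\{q(\theta,\alpha):\theta\in S_k(\delta)\}\le M$. (A2) For every $k\ge1$ and $\theta\in\Theta_k$ there exists $\eta_\theta>0$ such that $V(u_{\theta,\eta_\theta},f^\star)+V(f^\star,l_{\theta,\eta_\theta})+V(f^\star,u_{\theta,\eta_\theta})+V(u_{\theta,\eta_\theta},f_\theta)<\infty$. (O1)($k^\star+1$) There exist $C_2,D_1(k^\star+1)>0$ such that, for every sequence $\{\delta_n\}$ decreasing to $0$ and all $n\ge1$, $\pi_{k^\star+1}\{\theta\in\Theta_{k^\star+1}:H(\theta)\le\delta_n\}\le C_2\delta_n^{D_1(k^\star+1)/2}$. (O2)($k^\star+1$) There exist $C_3>0$ and a sequence $\{\mathcal F_n^{k^\star+1}\}$, $\mathcal F_n^{k^\star+1}\subset\Theta_{k^\star+1}$, such that, for all $n\ge1$, $\pi_{k^\star+1}\{(\mathcal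 F_n^{k^\star+1})^c\}\le C_3n^{-D_1(k^\star+1)/2}$. (O3) There exist $\beta_1,L,D_2(k^\star)>0$ and $\beta_2\ge0$ such that, for all $n\ge1$, $$P^{\star n}\{\mathbb B_n(k^\star)<(\beta_1(\log n)^{\beta_2}n^{D_2(k^\star)/2})^{-1}\}\le L\frac{(\log n)^{3D_1(k^\star+1)/2+\beta_2}}{n^{[D_1(k^\star+1)-D_2(k^\star)]/2}}.$$ Constants. $C_1=5(1+\log^2M)/(2\alpha^2)$ with $\alpha,M$ the constants of (A1) (for the index $k=k^\star+1$). $n_0$ is the smallest integer $n$ such that $4\max_{m\ge n}\{m^{-1}\log[\beta_1(\log m)^{\beta_2}m^{D_2(k^\star)/2}]\}\le e^{-2}/2$, and $\delta_0=4\max_{m\ge n_0}\{m^{-1}\log[\beta_1(\log m)^{\beta_2}m^{D_2(k^\star)/2}]\}$. Given any $s>0$, for $k=k^\star+1$ and $n\ge2$, $\delta_{k,n}=\delta_{k,1}n^{-1}\log^3n$, where $\delta_{k,1}$ is any number with $$\delta_{k,1}\ge128(1+s)(C_1+2)[D_1(k)-D_2(k^\star)]\ \vee\ 128C_1D_1(k)\ \vee\ (\log n_0)^{-3}.$$ *)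

(* Defs.v *)
From HB Require Import structures.
From mathcomp Require Import all_boot all_order all_algebra.
From mathcomp Require Import all_classical all_reals all_analysis.
From mathcomp Require Import measurable_realfun.

Set Implicit Arguments.
Unset Strict Implicit.
Unset Printing Implicit Defensive.

Import Order.TTheory GRing.Theory Num.Theory.
Import numFieldNormedType.Exports.

Local Open Scope classical_set_scope.
Local Open Scope ring_scope.

Section constants.
Context (R : realType).

Definition threshold (beta1 beta2 D2 : R) (n : nat) : R :=
  beta1 * ln n%:R `^ beta2 * n%:R `^ (D2 / 2).

Definition rate (beta2 D1 D2 : R) (n : nat) : R :=
  ln n%:R `^ (3 * D1 / 2 + beta2) / n%:R `^ ((D1 - D2) / 2).

(* For n >= 1 this supremum is attained: the terms tend to 0 and are eventually
   positive because D2 > 0.  For the same reason the term of index 1 does not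
   contribute when its logarithm should be -oo (here [ln 0 = 0]). *)
Definition max_log_threshold (beta1 beta2 D2 : R) (n : nat) : R :=
  sup [set m%:R^-1 * ln (threshold beta1 beta2 D2 m) | m in
         [set m | (n <= m)%N]].

Definition small_from (beta1 beta2 D2 : R) (n : nat) : Prop :=
  (0 < n)%N /\ 4 * max_log_threshold beta1 beta2 D2 n <= expR (- 2) / 2.

Definition is_n0 (beta1 beta2 D2 : R) (n0 : nat) : Prop :=
  small_from beta1 beta2 D2 n0 /\
  forall n, small_from beta1 beta2 D2 n -> (n0 <= n)%N.

Definition delta0 (beta1 beta2 D2 : R) (n0 : nat) : R :=
  4 * max_log_threshold beta1 beta2 D2 n0.

Definition C1_const (alpha m : R) : R := 5 * (1 + ln m ^+ 2) / (2 * alpha ^+ 2).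

(* [ln 1 = 0] and [0^-1 = +oo] in [\bar R]: no delta1 is admissible when
   n0 = 1. *)
Definition admissible_delta1 (c1 s D1 D2 : R) (n0 : nat) (delta1 : R) : Prop :=
  (maxe (maxe (128 * (1 + s) * (c1 + 2) * (D1 - D2))%:E (128 * c1 * D1)%:E)
        ((ln n0%:R ^+ 3)%:E)^-1 <= delta1%:E)%E.

Definition delta_n (delta1 : R) (n : nat) : R :=
  delta1 * n%:R^-1 * ln n%:R ^+ 3.

(* The largest integer strictly smaller than a, i.e., a - 1 if a is an integer. *)
Definition strict_floor (a : R) : int := Num.ceil a - 1.

End constants.

Local Open Scope ereal_scope.

(* The library's measure instance on [pushforward m f] takes the proof of
   measurability of [f] as an argument, hence this named version of it. *)
Definition image_measure d1 d2 (T1 : measurableType d1)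
    (T2 : measurableType d2) (R : realType) (m : {measure set T1 -> \bar R})
    (f : T1 -> T2) (mf : measurable_fun setT f) : {measure set T2 -> \bar R} :=
  measure_function_pushforward__canonical__measure_function_Measure m mf.

Section power_measure.
Context d (T : measurableType d) (R : realType).

Definition tuple_cons n (x : n.-tuple T * T) : n.+1.-tuple T :=
  [the n.+1.-tuple T of x.2 :: x.1].

Lemma measurable_tuple_cons n : measurable_fun setT (@tuple_cons n).
Proof. exact: measurable_cons. Qed.

(* The n-fold product measure; [power_measureE] gives its value on boxes. *)
Fixpoint power_measure (m : {sigma_finite_measure set T -> \bar R}) n :
    {measure set (n.-tuple T) -> \bar R} :=
  if n is n'.+1
  then image_measure (power_measure m n' \x m) (@measurable_tuple_cons n')
  else @dirac _ _ [tuple] R.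

Lemma power_measureE (m : {sigma_finite_measure set T -> \bar R}) n
    (A : 'I_n -> set T) : (forall i, measurable (A i)) ->
  power_measure m n [set t | forall i, A i (tnth t i)] = \prod_(i < n) m (A i).
Proof.
elim: n A => [|n IHn] A mA.
  by rewrite big_ord0 /= diracE mem_set//= => -[].
rewrite big_ord_recl muleC -IHn//= /pushforward.
rewrite (_ : _ @^-1` _ =
    [set t | forall i, A (lift ord0 i) (tnth t i)] `*` A ord0).
  rewrite product_measure1E//.
  rewrite (_ : [set t | _] =
     \bigcap_(i in [set: 'I_n]) ((@tnth n T)^~ i @^-1` A (lift ord0 i))).
    apply: fin_bigcap_measurable => // i _.
    by rewrite -[X in measurable X]setTI; exact: measurable_tnth.
  by apply/seteqP; split => [t tA i _|t tA i]; exact: tA.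
apply/seteqP; split => -[t x] /=.
  move=> xtA; split => [i|]; last exact: (xtA ord0).
  by have := xtA (lift ord0 i); rewrite tnthS.
move=> [tA Ax] i; have [j ->|->//] := unliftP ord0 i.
by rewrite tnthS.
Qed.

End power_measure.

Section product_law.
Context d (T : measurableType d) (R : realType).
Variables (P : probability T R) (n : nat).

Definition product_law : set (n.-tuple T) -> \bar R := power_measure P n.

HB.instance Definition _ := Measure.on product_law.

Let product_law_setT : product_law setT = 1.
Proof.
have -> : [set: n.-tuple T] = [set t | forall i : 'I_n, setT (tnth t i)].
  by apply/seteqP; split.
rewrite /product_law (@power_measureE _ _ _ _ _ (fun=> setT))// big1// => i _.
exact: probability_setT.
Qed.

HB.instance Definition _ :=
  Measure_isProbability.Build _ _ _ product_law product_law_setT.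

End product_law.

Section lebesgue_rV.
Context (R : realType).

(* The entrywise topology of ['rV[R]_n] is the Euclidean one. *)
Definition borel_rV n := g_sigma_algebraType (@open 'rV[R]_n).

Definition rV_of_tuple n (t : n.-tuple R) : borel_rV n := \row_i tnth t i.

Lemma measurable_rV_of_tuple n : measurable_fun setT (@rV_of_tuple n).
Proof.
apply: measurability => /=; first by [].
move=> _ [U oU <-]; rewrite setTI.
pose c (q : 'rV[rat]_n) : 'rV[R]_n := map_mx ratr q.
pose B (qk : 'rV[rat]_n * nat) : set 'rV[R]_n := ball (c qk.1) qk.2.+1%:R^-1.
have -> : @rV_of_tuple n @^-1` U =
    \bigcup_(qk in [set qk | B qk `<=` U]) (@rV_of_tuple n @^-1` B qk).
  apply/seteqP; split => [t Ut|t [qk BU Bt]]; last exact: BU.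
  have /nbhs_ballP[e /= e0 eU] : nbhs (rV_of_tuple t : 'rV[R]_n) U.
    exact: open_nbhs_nbhs.
  have [k ke] : exists k : nat, (k.+1%:R^-1 + k.+1%:R^-1 < e :> R)%R.
    have [k _ /(_ _ (leqnn k))] := near_infty_natSinv_lt (PosNum (divr_gt0 e0 (ltr0n _ 2))).
    move=> /= ke; exists k; rewrite [ltRHS](splitr e); exact: ltrD.
  have k0 : (0 < k.+1%:R^-1 :> R)%R by rewrite invr_gt0.
  have /choice[q qt] : forall i, exists q : rat,
      (`|ratr q - tnth t i| < k.+1%:R^-1)%R.
    move=> i; have [|q] := @rat_in_itvoo R (tnth t i - k.+1%:R^-1)%R (tnth t i + k.+1%:R^-1)%R.
      by rewrite ltrD2l gt0_cp.
    rewrite in_itv/= => /andP[q1 q2]; exists q.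
    by rewrite ltr_distl q1 q2.
  have qtB : ball (c (\row_i q i)) k.+1%:R^-1 (rV_of_tuple t : 'rV[R]_n).
    by split => // i j; rewrite !mxE /ball/=.
  exists (\row_i q i, k) => //= y By; apply: eU.
  apply: le_ball (ltW ke) _ _.
  by apply: ball_triangle By; exact: ball_sym.
rewrite bigcup_mkcond; apply: countable_bigcupT_measurable => [|qk].
  exact: countableP.
case: ifPn => // _.
have -> : @rV_of_tuple n @^-1` B qk = \bigcap_(i in [set: 'I_n])
    ((@tnth n R)^~ i @^-1` ball (c qk.1 ord0 i) qk.2.+1%:R^-1).
  apply/seteqP; split => [t [_ Bt] i _|t Bt].
    by have := Bt ord0 i; rewrite [X in ball _ _ X]mxE.
  split => [|i j]; first by rewrite invr_gt0.
  by rewrite (ord1 i) [X in ball _ _ X]mxE; exact: (Bt j I).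
apply: fin_bigcap_measurable => // i _.
rewrite -[X in measurable X]setTI; apply: measurable_tnth => //.
exact: measurable_ball.
Qed.

Definition lebesgue_rV n : {measure set (borel_rV n) -> \bar R} :=
  image_measure (power_measure (@lebesgue_measure R) n)
    (@measurable_rV_of_tuple n).

End lebesgue_rV.

Definition euclid_dist (R : realType) n (x y : 'rV[R]_n) : R :=
  Num.sqrt (\sum_i (x ord0 i - y ord0 i) ^+ 2)%R.

Unset Implicit Arguments.

(* Theta k is a subset of R^(pdim k).  The parameter sets of different levels
   may have different dimensions, so the inclusion of Theta k in Theta (k+1) is
   an injection [incl k], which is only required to preserve the densities.
   The strict positivity of the densities expresses that the log-densities are
   real-valued. Values of [incl], [dens] and [law] outside of Theta k are
   irrelevant. *)
Record model d (Z : measurableType d) (R : realType)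
    (mu : {measure set Z -> \bar R}) := Model {
  pdim : nat -> nat ;
  Theta : forall k, set 'rV[R]_(pdim k) ;
  incl : forall k, 'rV[R]_(pdim k) -> 'rV[R]_(pdim k.+1) ;
  dens : forall k, 'rV[R]_(pdim k) -> Z -> R ;
  law : forall k, 'rV[R]_(pdim k) -> probability Z R ;
  Theta0 : Theta 0%N = set0 ;
  incl_Theta : forall k t, Theta k t -> Theta k.+1 (incl k t) ;
  incl_inj : forall k, {in Theta k &, injective (incl k)} ;
  dens_incl : forall k t, Theta k t -> dens k.+1 (incl k t) = dens k t ;
  dens_gt0 : forall k t z, Theta k t -> (0 < dens k t z)%R ;
  measurable_dens : forall k t, Theta k t -> measurable_fun setT (dens k t) ;
  lawE : forall k t A, Theta k t -> measurable A ->
    law k t A = \int[mu]_(z in A) (dens k t z)%:E ;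
  compact_Theta : forall k, (0 < k)%N -> compact (Theta k) ;
  continuous_loglik : forall k z, (0 < k)%N ->
    {within Theta k, continuous (fun t => ln (dens k t z))} }.

Set Implicit Arguments.

Arguments model {d Z R} mu.
Arguments pdim {d Z R mu} _ _.
Arguments Theta {d Z R mu} _ _ _.
Arguments incl {d Z R mu} _ {k} _.
Arguments dens {d Z R mu} _ {k} _ _.
Arguments law {d Z R mu} _ {k} _.

Section model_theory.
Context d (Z : measurableType d) (R : realType).
Variables (mu : {measure set Z -> \bar R}) (M : model mu).
Local Notation param k := 'rV[R]_(pdim M k).

Unset Implicit Arguments.

(* Theta (k-1), seen inside Theta k *)
Definition prev_Theta k : set (param k) :=
  match k with
  | 0%N => set0
  | k'.+1 => @incl _ _ _ _ M k' @` Theta M k'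
  end.

Definition level k : set (param k) := Theta M k `\` prev_Theta k.

Set Implicit Arguments.

Definition is_order (ks : nat) (ts : param ks) : Prop :=
  level ks ts /\
  forall k (t : param k), level k t ->
    (forall A, measurable A -> law M t A = law M ts A) -> k = ks.

Definition loglik k (t : param k) (z : Z) : R := ln (dens M t z).

Definition loglik_n k (t : param k) n (zs : n.-tuple Z) : R :=
  (\sum_(i < n) loglik t (tnth zs i))%R.

(* [lne 0 = -oo], so that a vanishing g' makes the integrand infinite where
   g > 0, and g = 0 makes it 0. *)
Definition Vlog (g g' : Z -> \bar R) : \bar R :=
  \int[mu]_z (g z * (lne (g z) - lne (g' z)) ^+ 2).

Definition edens k (t : param k) (z : Z) : \bar R := (dens M t z)%:E.

Definition lower_env k (t : param k) (delta : R) (z : Z) : \bar R :=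
  ereal_inf [set edens t' z | t' in
               Theta M k `&` [set t' | (euclid_dist t t' < delta)%R]].

Definition upper_env k (t : param k) (delta : R) (z : Z) : \bar R :=
  ereal_sup [set edens t' z | t' in
               Theta M k `&` [set t' | (euclid_dist t t' < delta)%R]].

Section truth.
Variables (ks : nat) (ts : param ks).

(* The densities being positive, P* << P_theta always holds. *)
Definition KL k (t : param k) : \bar R :=
  \int[law M ts]_z (loglik ts z - loglik t z)%:E.

Definition KLinf k : \bar R := ereal_inf [set KL t | t in Theta M k].

Unset Implicit Arguments.

Definition KL_set k (delta : R) : set (param k) :=
  [set t | Theta M k t /\ KL t <= KLinf k + (delta / 2)%:E].

Set Implicit Arguments.

Definition qmom k (t : param k) (alpha : R) : \bar R :=
  \int[law M ts]_z ((loglik ts z - loglik t z) ^+ 2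
                  * expR (alpha * (loglik ts z - loglik t z)))%:E
  + Vlog (edens ts) (edens t).

Definition condA1_at k (alpha dbar m : R) : Prop :=
  [/\ (0 < alpha)%R, (0 < dbar)%R, (1 <= m)%R &
    forall delta : R, (0 < delta <= dbar)%R ->
      ereal_sup [set qmom t alpha | t in KL_set k delta] <= m%:E].

Definition condA1 : Prop :=
  forall k, (0 < k)%N -> exists alpha dbar m, condA1_at k alpha dbar m.

Definition condA2 : Prop :=
  forall k (t : param k), (0 < k)%N -> Theta M k t ->
    exists2 eta : R, (0 < eta)%R &
      Vlog (upper_env t eta) (edens ts) + Vlog (edens ts) (lower_env t eta)
      + Vlog (edens ts) (upper_env t eta) + Vlog (upper_env t eta) (edens t) < +oo.

Definition is_bracket (delta : R) (l u : Z -> R) : Prop :=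
  [/\ (forall z, 0 <= l z <= u z)%R,
      mu.-integrable setT (EFin \o l) /\ mu.-integrable setT (EFin \o u),
      \int[mu]_z (u z - l z)%:E <= delta%:E,
      \int[law M ts]_z (lne (u z)%:E - lne (l z)%:E) ^+ 2 <= (delta ^+ 2)%:E &
      \int[mu]_z ((u z - l z)%:E * (lne (u z)%:E - lne (edens ts z)) ^+ 2)
        <= (delta * ln delta ^+ 2)%:E /\
      \int[mu]_z ((l z)%:E * (lne (u z)%:E - lne (l z)%:E) ^+ 2)
        <= (delta * ln delta ^+ 2)%:E].

Definition bracket_cover (C : set (Z -> R)) (delta : R) (N : nat) : Prop :=
  exists l u : 'I_N -> Z -> R,
    (forall i, is_bracket delta (l i) (u i)) /\
    forall g, C g -> exists i, forall z, (l i z <= g z <= u i z)%R.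

Definition entropy (C : set (Z -> R)) (delta : R) : \bar R :=
  lne (ereal_inf [set N%:R%:E | N in bracket_cover C delta]).

Definition param_entropy k (T : set (param k)) (delta : R) : \bar R :=
  entropy (@dens _ _ _ _ M k @` T) delta.

End truth.

Unset Implicit Arguments.

Record prior := Prior {
  order_weight : nat -> R ;
  prior_dens : forall k, param k -> R ;
  prior_k : forall k, probability (borel_rV R (pdim M k)) R ;
  order_weight_ge0 : forall k, (0 <= order_weight k)%R ;
  order_weight_sum1 : \sum_(1 <= k <oo) (order_weight k)%:E = 1 ;
  prior_dens_ge0 : forall k (t : param k), (0 <= prior_dens k t)%R ;
  measurable_prior_dens : forall k,
    measurable_fun (Theta M k : set (borel_rV R (pdim M k))) (prior_dens k) ;
  prior_kE : forall k (A : set (borel_rV R (pdim M k))), (0 < k)%N ->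
    measurable A ->
    prior_k k A =
      \int[lebesgue_rV R (pdim M k)]_(t in A `&` Theta M k) (prior_dens k t)%:E }.

Set Implicit Arguments.

Section prior_theory.
Variable Pi : prior.

Definition evidence k n (zs : n.-tuple Z) : \bar R :=
  (order_weight Pi k)%:E
  * \int[prior_k Pi k]_(t in Theta M k) (expR (loglik_n t zs))%:E.

Definition posterior k n (zs : n.-tuple Z) : \bar R :=
  evidence k zs / \sum_(1 <= j <oo) evidence j zs.

(* The infimum of the empty set is +oo. *)
Definition order_est n (zs : n.-tuple Z) : \bar R :=
  ereal_inf [set k%:R%:E | k in
    [set k | (0 < k)%N /\ posterior k zs >= posterior k.+1 zs]].

Section truth.
Variables (ks : nat) (ts : param ks).

Definition Bn k n (zs : n.-tuple Z) : \bar R :=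
  (order_weight Pi k)%:E
  * \int[prior_k Pi k]_(t in Theta M k)
      (expR (loglik_n t zs - loglik_n ts zs))%:E.

Definition condO1 k (C2 D1 : R) : Prop :=
  [/\ (0 < C2)%R, (0 < D1)%R &
    forall delta : nat -> R, decreasing_seq delta ->
      (delta @ \oo --> (0 : R)%R) ->
    forall n, (0 < n)%N ->
      prior_k Pi k [set t | Theta M k t /\ KL ts t <= (delta n)%:E]
        <= (C2 * delta n `^ (D1 / 2))%:E].

Definition condO2 k (F : nat -> set (param k)) (C3 D1 : R) : Prop :=
  (0 < C3)%R /\
  forall n, (0 < n)%N ->
    [/\ measurable (F n : set (borel_rV R (pdim M k))), F n `<=` Theta M k &
        prior_k Pi k (Theta M k `\` F n) <= (C3 * n%:R `^ (- (D1 / 2)))%:E].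

(* For n = 1 and beta2 > 0 the threshold is 0, and so is its inverse in [R]: the
   condition is then void. *)
Definition condO3 (beta1 beta2 L D1 D2 : R) : Prop :=
  [/\ (0 < beta1)%R, (0 < L)%R, (0 < D2)%R, (0 <= beta2)%R &
    forall n, (0 < n)%N ->
      product_law (law M ts)
        [set zs : n.-tuple Z | Bn ks zs < ((threshold beta1 beta2 D2 n)^-1)%:E]
      <= (L * rate beta2 D1 D2 n)%:E].

End truth.
End prior_theory.
End model_theory.

Arguments prev_Theta {d Z R mu} M k _.
Arguments level {d Z R mu} M k _.
Arguments KL_set {d Z R mu} M {ks} ts k delta _.
Arguments prior {d Z R mu} M.
Arguments prior_k {d Z R mu M} p k.
Arguments order_weight {d Z R mu M} p k.
Arguments prior_dens {d Z R mu M} p {k} t.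

(* Main.v *)
(* The estimator exceeds the true order k0 only if B_n(k0) < B_n(k0 + 1), so by
   (O3) it suffices to control the event B_n(k0 + 1) >= 1/t_n, where t_n is the
   polynomially growing threshold of (O3).  Near the truth (H <= delta_n) and
   outside F_n, the likelihood ratio has mean 1, and Markov's inequality with (O1)
   and (O2) gives the announced rate.  Elsewhere the likelihood ratio is bounded
   uniformly by Chernoff's method applied to (u/f0)^lam, for f0 the true density,
   u the upper end of a bracket and lam a small power.  On the shell
   delta < H <= delta + delta_n, with delta = j delta_n, the exponential moment in
   (A1) makes the second-order term of E (u/f0)^lam of order lam^2 delta |ln delta|,
   so that lam of order 1/|ln delta| gives
   E (u/f0)^lam <= exp (- c delta / |ln delta|), which beats the entropy bound.
   Since delta_n is of order (ln n)^3/n, the shells contribute exp (- c (ln n)^2).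
   At a fixed distance from the truth the brackets are the envelopes of (A2) on
   small balls, finitely many of which suffice by compactness. *)

Require Import Defs.
From HB Require Import structures.
From mathcomp Require Import all_boot all_order all_algebra.
From mathcomp Require Import all_classical all_reals all_analysis.
From mathcomp Require Import measurable_realfun ring lra.

Set Implicit Arguments.
Unset Strict Implicit.
Unset Printing Implicit Defensive.

Import Order.TTheory GRing.Theory Num.Theory.
Import numFieldNormedType.Exports.

Local Open Scope classical_set_scope.
Local Open Scope ring_scope.

(** The entropy is beaten by a whole logarithm, not by a margin between constants. On the shell at D
    = j delta_n the gain in the exponent is n D / (K |ln D|), while the entropy is at most n D /
    (128 ln^2 D); once D <= exp (- K), half of the gain absorbs it. The shells are therefore used
    only up to a fixed distance eps, and the rest of the parameter set needs the separate
    compactness argument. The small power lam is forced by the brackets: u / f0 itself may have mean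
    1 + D / 4, which is not below 1, whereas ln (u / f0) has mean at most - 3 D / 4, and a small lam
    lets this first-order term win. Suprema over parameters are never integrated near the truth:
    there the mean-one property is used under the integral in the prior. Elsewhere the likelihood
    ratio is at most c outside an exceptional event. As B_n(k0 + 1) splits into three such
    integrals, c is one third of 1/t_n. *)

Local Notation plaw P n := (@product_law _ _ _ P n).

(** * Exponential inequalities *)

Section exponential_inequalities.
Context {R : realType}.
Implicit Types x y lam alpha a : R.

Lemma derive_ge0_ge0 (f df : R -> R) :
  (forall x, is_derive x 1 f (df x)) -> 0 <= f 0 ->
  (forall x, 0 <= x -> 0 <= df x) -> forall x, 0 <= x -> 0 <= f x.
Proof.
move=> fdf f0 df0 x x0.
have cf : {within `[0, x], continuous f}.
  apply: derivable_within_continuous => y _; exact: ex_derive.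
have [c + fE] := MVT_segment x0 (fun y _ => fdf y) cf.
rewrite in_itv/= => /andP[c0 _].
by rewrite -[f x](subrK (f 0)) fE addr_ge0// mulr_ge0 ?subr_ge0// df0.
Qed.

Lemma expRN_le_quadratic x : 0 <= x -> expR (- x) <= 1 - x + x ^+ 2 / 2.
Proof.
move=> x0; rewrite -subr_ge0; move: x x0.
apply: (@derive_ge0_ge0 (fun x : R => 1 - x + x ^+ 2 / 2 - expR (- x))
  (fun x : R => - 1 + x + expR (- x))).
- by move=> x; apply: is_derive_eq; rewrite /GRing.scale/=; field.
- by rewrite oppr0 expR0 expr0n/=; lra.
- by move=> x _; have := expR_ge1Dx (- x); lra.
Qed.

(** On the power series this holds termwise, as lam^i <= lam^2 for i >= 2; the proof differentiates
    twice instead. *)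
Lemma expRM_remainder_le x lam : 0 <= x -> 0 <= lam <= 1 ->
  expR (lam * x) - 1 - lam * x <= lam ^+ 2 * (expR x - 1 - x).
Proof.
move=> x0 /andP[l0 l1]; rewrite -subr_ge0; move: x x0.
apply: (@derive_ge0_ge0 _
  (fun x : R => lam * (lam * (expR x - 1) - (expR (lam * x) - 1)))).
- move=> x; apply: is_derive_eq; rewrite /GRing.scale/=; ring.
- by rewrite mulr0 expR0; lra.
- move=> x x0; apply: mulr_ge0 => //; move: x x0.
  apply: (@derive_ge0_ge0 _ (fun x : R => lam * (expR x - expR (lam * x)))).
  + move=> x; apply: is_derive_eq; rewrite /GRing.scale/=; ring.
  + by rewrite mulr0 expR0; lra.
  + by move=> x x0; rewrite mulr_ge0// subr_ge0 ler_expR ler_piMl.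
Qed.

(** Trades a square for a remainder exp X - 1 - X (with X = - x), whose mean follows from those of
    exp X and X. After expansion this is tanh (x / 2) <= x / 2. *)
Lemma sqr_le_expRN_remainder x : 0 <= x ->
  x ^+ 2 <= (x + 2) * (expR (- x) - 1 + x).
Proof.
move=> x0; rewrite -subr_ge0.
suff: 0 <= x - 2 + (x + 2) * expR (- x) by lra.
move: x x0; apply: (@derive_ge0_ge0 _ (fun x : R => 1 - (x + 1) * expR (- x))).
- move=> x; apply: is_derive_eq; rewrite /GRing.scale/=; ring.
- by rewrite oppr0 expR0; lra.
- move=> x x0; rewrite subr_ge0 expRN ler_pdivrMr ?expR_gt0// mul1r addrC.
  exact: expR_ge1Dx.
Qed.

(* Below -a the exponential moment of y takes over; above -a, the square of x is
   at most a + 2 times the remainder exp x - 1 - x. *)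
Lemma expRM_le x y lam alpha a : 0 <= lam <= 1 -> 0 <= alpha -> 0 <= a ->
    - x <= y ->
  expR (lam * x) <= 1 + lam * x +
    lam ^+ 2 / 2 * ((a + 2) * (expR x - 1 - x) +
                    expR (- (alpha * a)) * (y ^+ 2 * expR (alpha * y))).
Proof.
move=> l01 al0 a0 xy; have /andP[l0 l1] := l01.
have r0 : 0 <= expR x - 1 - x by have := expR_ge1Dx x; lra.
have e0 : 0 <= expR (- (alpha * a)) * (y ^+ 2 * expR (alpha * y)).
  by rewrite mulr_ge0 ?expR_ge0// mulr_ge0 ?expR_ge0 ?sqr_ge0.
suff h : expR (lam * x) - 1 - lam * x <= lam ^+ 2 / 2 *
    ((a + 2) * (expR x - 1 - x) +
     expR (- (alpha * a)) * (y ^+ 2 * expR (alpha * y))) by lra.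
have [x0|x0] := leP 0 x.
  apply: (le_trans (expRM_remainder_le x0 l01)).
  rewrite -mulrA ler_wpM2l ?sqr_ge0//.
  have : 0 <= a * (expR x - 1 - x) by exact: mulr_ge0.
  lra.
have lx : 0 <= - (lam * x) by rewrite -mulrN mulr_ge0// oppr_ge0 ltW.
have := expRN_le_quadratic lx; rewrite opprK sqrrN exprMn => h.
apply: (@le_trans _ _ (lam ^+ 2 / 2 * x ^+ 2)); first by lra.
rewrite ler_wpM2l ?mulr_ge0 ?sqr_ge0//.
have [xa|xa] := leP (- x) a.
  have := @sqr_le_expRN_remainder (- x); rewrite opprK sqrrN oppr_ge0.
  move=> /(_ (ltW x0)) h2.
  apply: (le_trans h2); rewrite -[leLHS]addr0 lerD//.
  by rewrite ler_wpM2r// lerD2r.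
rewrite -[leLHS]add0r lerD//; first by rewrite mulr_ge0// addr_ge0.
rewrite mulrCA -expRD.
have x2y : x ^+ 2 <= y ^+ 2.
  by rewrite -sqrrN ler_sqr ?nnegrE ?oppr_ge0 ?(ltW x0)//; lra.
rewrite (le_trans x2y)// ler_peMr ?sqr_ge0//.
by rewrite -expR0 ler_expR addrC -mulrBr mulr_ge0//; lra.
Qed.

End exponential_inequalities.

(** * Products and densities *)

Section product_law_lemmas.
Context d (T : measurableType d) {R : realType}.
Implicit Types P : probability T R.


Lemma measurable_prod_tnth n (g : T -> R) : measurable_fun setT g ->
  measurable_fun setT (fun zs : n.-tuple T => \prod_(i < n) g (tnth zs i)).
Proof.
move=> mg; apply: measurable_prod => i _.
by apply: (measurableT_comp mg); exact: measurable_tnth.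
Qed.

Lemma expectation_prod_le P n (g : T -> R) (a : R) :
  measurable_fun setT g -> (forall x, 0 <= g x) ->
  (\int[P]_x (g x)%:E <= a%:E)%E ->
  (\int[plaw P n]_zs (\prod_(i < n) g (tnth zs i))%:E <= (a ^+ n)%:E)%E.
Proof.
move=> mg g0 ga.
have a0 : 0 <= a.
  by rewrite -lee_fin (le_trans _ ga)// integral_ge0// => x _; rewrite lee_fin.
elim: n => [|n IH].
  rewrite (eq_integral (cst 1%E)); last by move=> zs _; rewrite big_ord0.
  rewrite integral_cst// mul1e expr0.
  by rewrite -[X in (_ <= X)%E](probability_setT (plaw P 0)).
(* By conversion: [power_measure] at [n.+1] is an image measure, and this form makes the change of
   variables applicable. *)
have E f : (\int[plaw P n.+1]_zs f zs =
    \int[pushforward (plaw P n \x P)%E (@tuple_cons _ _ n)]_zs f zs)%E by [].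
have mpr k := @measurable_prod_tnth k _ mg.
rewrite E ge0_integral_pushforward//=; last 2 first.
- by apply/measurable_EFinP; exact: (mpr n.+1).
- by move=> zs _; rewrite lee_fin prodr_ge0.
rewrite preimage_setT.
rewrite (eq_integral (fun x : n.-tuple T * T =>
  (g x.2 * \prod_(i < n) g (tnth x.1 i))%:E)); last first.
  move=> x _ /=; rewrite big_ord_recl; congr (_ * _)%:E.
  by apply: eq_bigr => i _; rewrite tnthS.
rewrite (@fubini_tonelli1 _ _ _ _ _ (plaw P n) P)//=; last 2 first.
- apply/measurable_EFinP; apply: measurable_funM.
    exact: measurableT_comp.
  exact: (measurableT_comp (mpr n)).
- by move=> x; rewrite lee_fin mulr_ge0// prodr_ge0.
rewrite /fubini_F/=.
apply: (@le_trans _ _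
    (\int[plaw P n]_x (a%:E * (\prod_(i < n) g (tnth x i))%:E))%E).
  apply: ge0_le_integral => //.
  - move=> x _; apply: integral_ge0 => y _.
    by rewrite lee_fin mulr_ge0// prodr_ge0.
  - apply: (@measurable_fun_fubini_tonelli_F _ _ _ _ _ P
      (fun x : n.-tuple T * T => (g x.2 * \prod_(i < n) g (tnth x.1 i))%:E)) => //.
    + apply/measurable_EFinP; apply: measurable_funM.
        by apply: measurableT_comp.
      exact: (measurableT_comp (mpr n)).
    + by move=> x; rewrite lee_fin mulr_ge0// prodr_ge0.
  - apply/measurable_EFinP; apply: measurable_funM => //.
    exact: (mpr n).
  - move=> x _; under eq_integral do rewrite EFinM.
    rewrite ge0_integralZr//.
    + by rewrite lee_wpmul2r// lee_fin prodr_ge0.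
    + exact/measurable_EFinP.
    + by move=> y _; rewrite lee_fin.
    + by rewrite lee_fin prodr_ge0.
rewrite ge0_integralZl//.
- rewrite exprS EFinM; exact: lee_wpmul2l.
- by apply/measurable_EFinP; exact: (mpr n).
- by move=> x _; rewrite lee_fin prodr_ge0.
- exact: measurable_tuple_cons.
Qed.

Lemma ge0_markov d' (T' : measurableType d') (mu : {measure set T' -> \bar R})
    (f : T' -> \bar R) (c : R) :
  measurable_fun setT f -> (forall x, 0 <= f x)%E -> 0 < c ->
  (mu [set x | c%:E <= f x] <= c^-1%:E * \int[mu]_x f x)%E.
Proof.
move=> mf f0 c0.
have := le_integral_abse mu measurableT mf c0.
rewrite setTI; under [X in mu X]eq_set do rewrite gee0_abs//.
under eq_integral do rewrite gee0_abs//.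
by rewrite lee_pdivlMl.
Qed.

Lemma chernoff_prod P n (g : T -> R) (a c : R) :
  measurable_fun setT g -> (forall x, 0 <= g x) -> 0 < c ->
  (\int[P]_x (g x)%:E <= a%:E)%E ->
  (plaw P n [set zs | (c <= \prod_(i < n) g (tnth zs i))%R]
     <= (c^-1 * a ^+ n)%:E)%E.
Proof.
move=> mg g0 c0 ga.
have h := @ge0_markov _ _ (plaw P n)
  (fun zs => (\prod_(i < n) g (tnth zs i))%:E) c.
apply: (le_trans (h _ _ c0)).
- by apply/measurable_EFinP; exact: measurable_prod_tnth.
- by move=> zs; rewrite lee_fin prodr_ge0.
- rewrite EFinM lee_wpmul2l ?lee_fin ?invr_ge0 ?(ltW c0)//.
  exact: expectation_prod_le.
Qed.

End product_law_lemmas.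

Section density.
Context d (T : measurableType d) {R : realType}.
Variables (mu nu : {measure set T -> \bar R}) (f : T -> R).
Hypotheses (f0 : forall x, 0 <= f x) (mf : measurable_fun setT f).
Hypothesis nuE : forall A, measurable A ->
  nu A = (\int[mu]_(x in A) (f x)%:E)%E.

Import HBNNSimple.

Let integral_density_nnsfun (h : {nnsfun T >-> R}) :
  (\int[nu]_x (h x)%:E = \int[mu]_x ((h x)%:E * (f x)%:E))%E.
Proof.
rewrite integralT_nnsfun sintegralE.
have mindic r : measurable (h @^-1` [set r]) by [].
transitivity (\int[mu]_x (\sum_(y \in range h)
    (y%:E * (\1_(h @^-1` [set y]) x * f x)%:E)))%E; last first.
  apply: eq_integral => x _; rewrite [in RHS]fimfunE -fsumEFin// ge0_mule_fsuml.
    by apply: eq_fsbigr => y _; rewrite -!EFinM mulrA.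
  by move=> y; exact: nnfun_muleindic_ge0.
rewrite ge0_integral_fsum//; last 2 first.
- move=> y; apply/measurable_EFinP; apply: measurable_funM => //.
  exact: measurable_funM.
- move=> y x _; rewrite -EFinM lee_fin mulrA mulr_ge0//.
  exact: nnfun_muleindic_ge0.
apply: eq_fsbigr => r /[!inE] -[x _ hx].
rewrite ge0_integralZl//; last 3 first.
- by apply/measurable_EFinP; apply: measurable_funM.
- by move=> y _; rewrite lee_fin mulr_ge0.
- by rewrite lee_fin -hx.
congr *%E; rewrite nuE// integral_mkcond; apply: eq_integral => y _.
by rewrite epatch_indic muleC.
Qed.

(** [mu] is not assumed sigma-finite, so the formula is passed from simple functions to the limit by
    monotone convergence, without a Radon-Nikodym derivative. *)
Lemma ge0_integral_density (h : T -> \bar R) :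
  measurable_fun setT h -> (forall x, 0 <= h x)%E ->
  (\int[nu]_x h x = \int[mu]_x (h x * (f x)%:E))%E.
Proof.
move=> mh h0; pose g := nnsfun_approx measurableT mh.
have gh x : (EFin \o g n) x @[n --> \oo] --> h x by exact: cvg_nnsfun_approx.
have ndg x : {homo (fun n => g n x) : m n / (m <= n)%N >-> m <= n}.
  by move=> m n mn; exact/lefP/nd_nnsfun_approx.
have -> : (\int[nu]_x h x = limn (fun n => \int[nu]_x (g n x)%:E))%E.
  under eq_integral do rewrite -(cvg_lim _ (gh _))//.
  apply: monotone_convergence => //.
  - by move=> n; exact/measurable_EFinP.
  - by move=> n x _; rewrite lee_fin.
  - by move=> x _ m n mn; rewrite lee_fin ndg.
have -> : (\int[mu]_x (h x * (f x)%:E) =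
    limn (fun n => \int[mu]_x ((g n x)%:E * (f x)%:E)))%E.
  have ghf x : ((EFin \o g n) x * (f x)%:E)%E @[n --> \oo] --> (h x * (f x)%:E)%E.
    exact: cvgeZr.
  under eq_integral do rewrite -(cvg_lim _ (ghf _))//.
  apply: monotone_convergence => //.
  - by move=> n; apply/measurable_EFinP; exact: measurable_funM.
  - by move=> n x _; rewrite lee_fin mulr_ge0.
  - by move=> x _ m n mn; rewrite lee_fin ler_wpM2r// ndg.
by congr (limn _); apply/funext => n; exact: integral_density_nnsfun.
Qed.

End density.

(** * Measurability *)

Section caratheodory.
Context {R : realType} (n : nat).
Implicit Types (A : set 'rV[R]_n) (t : 'rV[R]_n).

Lemma within_continuous_ball (A : set 'rV[R]_n) (g : 'rV[R]_n -> R) (t : 'rV[R]_n) (e : R) :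
  {within A, continuous g} -> A t -> 0 < e ->
  exists2 r : R, 0 < r & forall t', A t' -> ball t r t' -> `|g t - g t'| < e.
Proof.
move=> /subspace_continuousP cg At e0.
have /cvgrPdist_lt/(_ _ e0) := cg t At.
rewrite near_withinE => /nbhs_ballP[r r0 h]; exists r => // t' At' tt'.
exact: h.
Qed.

(** Rational points need not lie in A, so a point of A is picked in each ball with rational centre
    and radius 1/(k+1) that meets A. *)
Lemma countable_dense_subset A : A !=set0 ->
  exists s : nat -> 'rV[R]_n, (forall i, A (s i)) /\
    forall t, A t -> forall e : R, 0 < e -> exists i, ball t e (s i).
Proof.
move=> [a Aa]; pose c (q : 'rV[rat]_n) : 'rV[R]_n := map_mx ratr q.
have /choice[f fP] (qk : 'rV[rat]_n * nat) : exists p, A p /\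
    ((A `&` ball (c qk.1) qk.2.+1%:R^-1) !=set0 -> ball (c qk.1) qk.2.+1%:R^-1 p).
  have [[p [Ap Bp]]|h] := pselect ((A `&` ball (c qk.1) qk.2.+1%:R^-1) !=set0).
    by exists p.
  by exists a.
exists (fun i => if unpickle i is Some qk then f qk else a); split => [i|t At e e0].
  by case: unpickle => [qk|//]; have [] := fP qk.
have [k ke] : exists k : nat, k.+1%:R^-1 + k.+1%:R^-1 < e.
  have [k _ /(_ _ (leqnn k))/= ke] :=
    near_infty_natSinv_lt (PosNum (divr_gt0 e0 (ltr0n _ 2))).
  by exists k; rewrite [ltRHS](splitr e); exact: ltrD.
have k0 : 0 < k.+1%:R^-1 :> R by rewrite invr_gt0.
have /choice[q qt] : forall i, exists q : rat, `|ratr q - t ord0 i| < k.+1%:R^-1.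
  move=> i; have [|q] := @rat_in_itvoo R (t ord0 i - k.+1%:R^-1) (t ord0 i + k.+1%:R^-1).
    by rewrite ltrD2l gt0_cp.
  by rewrite in_itv/= => /andP[q1 q2]; exists q; rewrite ltr_distl q1 q2.
have qtB : ball (c (\row_i q i)) k.+1%:R^-1 t.
  by split => // i j; rewrite !mxE /ball/= ord1.
exists (pickle (\row_i q i, k)); rewrite pickleK.
have [_ /(_ _)/= h] := fP (\row_i q i, k).
apply: le_ball (ltW ke) _ _; apply: ball_triangle (ball_sym qtB) _.
by apply: h; exists t.
Qed.

Lemma borel_rV_ball t (r : R) : measurable (ball t r : set (borel_rV R n)).
Proof. by apply: sub_sigma_algebra; exact: ball_open. Qed.

Lemma borel_rV_compact A : compact A -> measurable (A : set (borel_rV R n)).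
Proof.
move=> cA; rewrite -(setCK A); apply: measurableC; apply: sub_sigma_algebra.
by apply: closed_openC; apply: compact_closed => //; exact: norm_hausdorff.
Qed.

(** Tonelli's theorem for the prior and the sample requires joint measurability, while the model
    gives continuity in the parameter and measurability in the observation. *)
Lemma caratheodory_measurable d (Z : measurableType d) A
    (f : 'rV[R]_n -> Z -> R) :
  measurable (A : set (borel_rV R n)) ->
  (forall z, {within A, continuous (f ^~ z)}) ->
  (forall t, A t -> measurable_fun setT (f t)) ->
  measurable_fun ((A : set (borel_rV R n)) `*` setT) (fun x => f x.1 x.2).
Proof.
move=> mA cf mf.
have [->|/set0P /countable_dense_subset[s [sA sd]]] := eqVneq A set0.
  by rewrite set0X; exact: measurable_fun_set0.
move=> _; apply: (measurability _ (RGenOInfty.measurableE R)) => //=.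
move=> _ [_ [y ->] <-].
(* f t z > y if and only if, for some p and q, all points s_i of the dense sequence with t within
   1/(q+1) satisfy f s_i z >= y + 1/(p+1). The margin 1/(p+1) keeps the inequality strict when s_i
   tends to t. *)
rewrite (_ : _ `&` _ = \bigcup_p \bigcup_q \bigcap_i
   ((A `&` ~` ball (s i) q.+1%:R^-1) `*` setT `|`
    A `*` [set z | y + p.+1%:R^-1 <= f (s i) z])).
  apply: bigcup_measurable => p _; apply: bigcup_measurable => q _.
  apply: bigcapT_measurable => i; apply: measurableU; apply: measurableX => //.
    by apply: measurableI => //; apply: measurableC; exact: borel_rV_ball.
  rewrite -[X in measurable X]setTI.
  rewrite (_ : [set z | _] = f (s i) @^-1` `[y + p.+1%:R^-1, +oo[).
    exact: mf.
  by apply/seteqP; split => z /=; rewrite in_itv/= andbT.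
apply/seteqP; split => [[t z] /= [[At _]]|[t z] /= [p _] [q _] h].
  rewrite in_itv/= andbT => yf.
  have e0 : 0 < (f t z - y) / 2 by rewrite divr_gt0// subr_gt0.
  have [r r0 rf] := within_continuous_ball (cf z) At e0.
  have [p _ /(_ _ (leqnn p))/= pe] := near_infty_natSinv_lt (PosNum e0).
  have {}pe : p.+1%:R^-1 < (f t z - y) / 2 := pe.
  have [q _ /(_ _ (leqnn q))/= qr] := near_infty_natSinv_lt (PosNum r0).
  exists p => //; exists q => // i _ /=.
  have [B|B] := pselect (ball (s i) q.+1%:R^-1 t); [right|by left].
  split => //; have := rf _ (sA i) (le_ball (ltW qr) (ball_sym B)).
  rewrite ltr_norml => /andP[_ h].
  apply: (@le_trans _ _ (y + (f t z - y) / 2)); last by lra.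
  by rewrite lerD2l ltW.
have At : A t by case: (h 0%N I) => -[]//= [].
split => //; rewrite in_itv/= andbT.
have p0 : 0 < p.+1%:R^-1 :> R by rewrite invr_gt0.
have q0 : 0 < q.+1%:R^-1 :> R by rewrite invr_gt0.
have [r r0 rf] := within_continuous_ball (cf z) At p0.
have [|i ti] := sd t At (Num.min r q.+1%:R^-1); first by rewrite lt_min r0.
have := rf _ (sA i) (le_ball _ ti); rewrite ge_min lexx => /(_ isT).
rewrite ltr_norml => /andP[tz _].
case: (h i I) => -[/=]; last first.
  move=> _ yf; rewrite -(ltrD2r (- f (s i) z)).
  by apply: le_lt_trans tz; rewrite lerBlDr addrC lerBrDr.
move=> [_ []]; apply: ball_sym; apply: le_ball ti.
by rewrite ge_min lexx orbT.
by apply: measurableX.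
Qed.

End caratheodory.

Section restricted_fubini.
Context d1 d2 (T1 : measurableType d1) (T2 : measurableType d2) {R : realType}.
Variables (m1 : probability T1 R) (m2 : probability T2 R) (A : set T1).
Variable f : T1 * T2 -> \bar R.
Hypotheses (mA : measurable A) (mf : measurable_fun (A `*` setT) f).
Hypothesis f0 : forall x, (0 <= f x)%E.

(** The model says nothing of the densities off Theta k, so the integrand is only measurable over A;
    extending it by 0 gives a function to which Tonelli's theorem applies. *)
Let fA := f \_ (A `*` setT).

Let mfA : measurable_fun setT fA.
Proof. by apply/(measurable_restrictT _ _).1 => //; exact: measurableX. Qed.

Let fA0 x : (0 <= fA x)%E.
Proof. by rewrite /fA patchE; case: ifP. Qed.

Let fAE x y : fA (x, y) = ((fun x => f (x, y)) \_ A) x.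
Proof.
rewrite /fA !patchE; congr (if _ then _ else _).
by apply/idP/idP => /set_mem => [[]|] *; exact/mem_set.
Qed.

Lemma measurable_integral_fst :
  measurable_fun setT (fun y => \int[m1]_(x in A) f (x, y))%E.
Proof.
have := @measurable_fun_fubini_tonelli_G _ _ _ _ _ m1 _ mfA fA0.
apply: eq_measurable_fun => y _; rewrite /fubini_G [RHS]integral_mkcond.
by apply: eq_integral => x _; rewrite fAE.
Qed.

Lemma measurable_integral_snd : measurable_fun A (fun x => \int[m2]_y f (x, y))%E.
Proof.
apply: (eq_measurable_fun (fubini_F m2 fA)); last first.
  by apply: measurable_funTS; exact: measurable_fun_fubini_tonelli_F.
move=> x /[!inE] xA; rewrite /fubini_F.
by apply: eq_integral => y _; rewrite /fA patchE mem_set.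
Qed.

Lemma exchange_integral_set :
  (\int[m2]_y \int[m1]_(x in A) f (x, y) =
   \int[m1]_(x in A) \int[m2]_y f (x, y))%E.
Proof.
have := @fubini_tonelli _ _ _ _ _ m1 m2 _ mfA fA0.
rewrite /fubini_F /fubini_G => h; rewrite [RHS]integral_mkcond.
transitivity (\int[m1]_x \int[m2]_y fA (x, y))%E.
  rewrite h; apply: eq_integral => y _; rewrite [LHS]integral_mkcond.
  by apply: eq_integral => x _; rewrite fAE.
apply: eq_integral => x _; rewrite patchE; case: ifPn => xA.
  by apply: eq_integral => y _; rewrite fAE patchE xA.
rewrite integral0_eq// => y _; rewrite fAE patchE.
by rewrite (negbTE xA).
Qed.

End restricted_fubini.

Section model_measurability.
Context d (Z : measurableType d) {R : realType} (mu : {measure set Z -> \bar R}).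
Variable M : model mu.
Local Notation B k := (borel_rV R (pdim M k)).

End model_measurability.

Section model_measurability.
Context d (Z : measurableType d) {R : realType} (mu : {measure set Z -> \bar R}).
Variable M : model mu.
Local Notation B k := (borel_rV R (pdim M k)).

Lemma Theta_gt0 k t : Theta M k t -> (0 < k)%N.
Proof. by case: k t => // t; rewrite Theta0. Qed.

Lemma measurable_Theta k : measurable (Theta M k : set (B k)).
Proof.
case: k => [|k]; first by rewrite Theta0.
by apply: borel_rV_compact; exact: compact_Theta.
Qed.

Lemma measurable_loglik k t : Theta M k t -> measurable_fun setT (loglik t).
Proof.
by move=> Tt; exact: (measurableT_comp (@measurable_ln R) (measurable_dens _ _ _ _ M _ _ Tt)).
Qed.

Lemma expR_loglik k t z : Theta M k t -> expR (loglik t z) = dens M t z.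
Proof. by move=> Tt; rewrite lnK// posrE dens_gt0. Qed.

Lemma continuous_Theta_loglik k z : {within Theta M k, continuous (fun t => loglik t z)}.
Proof.
case: k => [|k]; last exact: continuous_loglik.
by rewrite Theta0; exact: continuous_subspace0.
Qed.

Lemma measurable_loglik_pair k :
  measurable_fun ((Theta M k : set (B k)) `*` setT) (fun x => loglik x.1 x.2).
Proof.
apply: caratheodory_measurable.
- exact: measurable_Theta.
- by move=> z; exact: continuous_Theta_loglik.
- by move=> t; exact: measurable_loglik.
Qed.

Lemma measurable_loglik_n_pair k n :
  measurable_fun ((Theta M k : set (B k)) `*` [set: n.-tuple Z])
    (fun x => loglik_n x.1 x.2).
Proof.
apply: measurable_sum => i.
apply: (@measurable_comp _ _ _ _ _ _ ((Theta M k : set (B k)) `*` [set: Z])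
  (fun x => loglik x.1 x.2) _ (fun x : B k * n.-tuple Z => (x.1, tnth x.2 i))).
- by apply: measurableX => //; exact: measurable_Theta.
- by move=> _ [[t zs] [/= Tt _] <-].
- exact: measurable_loglik_pair.
- apply: measurable_funTS; apply: measurable_fun_pair => //.
  by apply: (measurableT_comp (measurable_tnth i)).
Qed.

Lemma measurable_loglik_n k t n : Theta M k t ->
  measurable_fun setT (fun zs : n.-tuple Z => loglik_n t zs).
Proof.
move=> Tt; apply: measurable_sum => i.
exact: (measurableT_comp (measurable_loglik Tt) (measurable_tnth i)).
Qed.

Lemma ge0_integral_law k t (h : Z -> \bar R) : Theta M k t ->
  measurable_fun setT h -> (forall z, 0 <= h z)%E ->
  (\int[law M t]_z h z = \int[mu]_z (h z * (dens M t z)%:E))%E.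
Proof.
move=> Tt mh h0; apply: ge0_integral_density => //.
- by move=> z; rewrite ltW// dens_gt0.
- exact: measurable_dens.
- by move=> A mA; exact: lawE.
Qed.

Lemma integral_dens k t : Theta M k t -> (\int[mu]_z (dens M t z)%:E = 1)%E.
Proof. by move=> Tt; rewrite -(lawE _ _ _ _ M _ _ _ Tt)// probability_setT. Qed.

Section truth.
Variables (ks : nat) (ts : 'rV[R]_(pdim M ks)).
Hypothesis Tts : Theta M ks ts.
Let P := law M ts.

Lemma measurable_loglikB k t : Theta M k t ->
  measurable_fun setT (fun z => loglik t z - loglik ts z).
Proof. by move=> Tt; apply: measurable_funB; exact: measurable_loglik. Qed.

Lemma expectation_loglik_ratio (g : Z -> R) :
  measurable_fun setT g -> (forall z, 0 <= g z) ->
  (\int[P]_z (g z / dens M ts z)%:E = \int[mu]_z (g z)%:E)%E.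
Proof.
move=> mg g0; rewrite ge0_integral_law//.
- apply: eq_integral => z _; rewrite -EFinM divfK//.
  by rewrite gt_eqF// dens_gt0.
- apply/measurable_EFinP; apply: measurable_funM => //.
  apply: (eq_measurable_fun (fun z => expR (- loglik ts z))).
    by move=> z _; rewrite expRN expR_loglik.
  apply: (measurableT_comp (@measurable_expR R)); apply: measurable_funN.
  exact: measurable_loglik.
- by move=> z; rewrite lee_fin divr_ge0// ltW// dens_gt0.
Qed.

Lemma expR_loglikB k t z : Theta M k t ->
  expR (loglik t z - loglik ts z) = dens M t z / dens M ts z.
Proof. by move=> Tt; rewrite expRB !expR_loglik. Qed.

Lemma expectation_ratio k t : Theta M k t ->
  (\int[P]_z (expR (loglik t z - loglik ts z))%:E = 1)%E.
Proof.
move=> Tt; under eq_integral do rewrite (expR_loglikB _ Tt).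
rewrite expectation_loglik_ratio ?integral_dens//.
- exact: measurable_dens.
- by move=> z; rewrite ltW// dens_gt0.
Qed.

Lemma expR_loglik_nB k (t : 'rV[R]_(pdim M k)) n (zs : n.-tuple Z) :
  expR (loglik_n t zs - loglik_n ts zs) =
  \prod_(i < n) expR (loglik t (tnth zs i) - loglik ts (tnth zs i)).
Proof. by rewrite -expR_sum -sumrB. Qed.

Lemma measurable_ratio_n k n (A : set (B k)) :
  measurable A -> A `<=` Theta M k ->
  measurable_fun (A `*` [set: n.-tuple Z])
    (fun x => (expR (loglik_n x.1 x.2 - loglik_n ts x.2))%:E).
Proof.
move=> mA AT; apply/measurable_EFinP; apply: (measurableT_comp (@measurable_expR R)).
apply: measurable_funB.
  apply: measurable_funS (@measurable_loglik_n_pair k n) => //.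
    by apply: measurableX => //; exact: measurable_Theta.
  exact: setSX.
apply: measurable_funTS.
by apply: (measurableT_comp (@measurable_loglik_n _ _ n Tts)).
Qed.

Lemma expectation_posterior_mass k n (pi : probability (B k) R) (A : set (B k)) :
  measurable A -> A `<=` Theta M k ->
  (\int[plaw P n]_zs \int[pi]_(t in A)
     (expR (loglik_n t zs - loglik_n ts zs))%:E <= pi A)%E.
Proof.
move=> mA AT.
rewrite (@exchange_integral_set _ _ _ _ _ pi (plaw P n) A
  (fun x => (expR (loglik_n x.1 x.2 - loglik_n ts x.2))%:E) mA) //; last first.
  exact: measurable_ratio_n.
rewrite -[leRHS]mul1e -integral_cst//; apply: ge0_le_integral => //.
- by move=> t _; apply: integral_ge0.
- apply: (@measurable_integral_snd _ _ _ _ _ (plaw P n) A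
    (fun x => (expR (loglik_n x.1 x.2 - loglik_n ts x.2))%:E) mA) => //.
  exact: measurable_ratio_n.
- move=> t /AT Tt /=; under eq_integral do rewrite expR_loglik_nB.
  apply: (le_trans (@expectation_prod_le _ _ _ P n
    (fun z => expR (loglik t z - loglik ts z)) 1 _ _ _)); last by rewrite expr1n.
  + apply: (measurableT_comp (@measurable_expR R)); exact: measurable_loglikB.
  + by move=> z; exact: expR_ge0.
  + by rewrite expectation_ratio.
Qed.

Lemma measurable_posterior_mass k n (pi : probability (B k) R) (A : set (B k)) :
  measurable A -> A `<=` Theta M k ->
  measurable_fun setT (fun zs : n.-tuple Z => \int[pi]_(t in A)
     (expR (loglik_n t zs - loglik_n ts zs))%:E)%E.
Proof.
move=> mA AT.
apply: (@measurable_integral_fst _ _ _ _ _ pi A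
    (fun x => (expR (loglik_n x.1 x.2 - loglik_n ts x.2))%:E) mA) => //.
exact: measurable_ratio_n.
Qed.

(* Markov's inequality, as the likelihood ratio has mean 1 at every t. *)
Lemma posterior_mass_ge k n (pi : probability (B k) R) (A : set (B k)) (c : R) :
  measurable A -> A `<=` Theta M k -> 0 < c ->
  (plaw P n [set zs | c%:E <= \int[pi]_(t in A)
     (expR (loglik_n t zs - loglik_n ts zs))%:E] <= c^-1%:E * pi A)%E.
Proof.
move=> mA AT c0.
apply: (le_trans (ge0_markov _ (@measurable_posterior_mass k n pi A mA AT) _ c0)).
  by move=> zs; exact: integral_ge0.
rewrite lee_wpmul2l ?lee_fin ?invr_ge0 ?(ltW c0)//.
exact: expectation_posterior_mass.
Qed.

Lemma measurable_KL_le k (c : \bar R) :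
  measurable ([set t | Theta M k t /\ (KL ts t <= c)%E] : set (B k)).
Proof.
have mY : measurable_fun ((Theta M k : set (B k)) `*` [set: Z])
    (fun x => (loglik ts x.2 - loglik x.1 x.2)%:E).
  apply/measurable_EFinP; apply: measurable_funB; last exact: measurable_loglik_pair.
  apply: measurable_funTS.
  by apply: (measurableT_comp (measurable_loglik Tts)).
(* The integrand of [KL] changes sign, so Tonelli's theorem is applied to its positive and negative
   parts. *)
have mp := @measurable_integral_snd _ _ _ _ _ P (Theta M k : set (B k)) _
  (@measurable_Theta k) (measurable_funepos mY).
have mn := @measurable_integral_snd _ _ _ _ _ P (Theta M k : set (B k)) _
  (@measurable_Theta k) (measurable_funeneg mY).
have mKL : measurable_fun (Theta M k : set (B k)) (KL ts (k := k) : B k -> \bar R).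
  apply: (eq_measurable_fun (fun t : B k =>
   \int[P]_z ((fun x => (loglik ts x.2 - loglik x.1 x.2)%:E)^\+ (t, z)) -
   \int[P]_z ((fun x => (loglik ts x.2 - loglik x.1 x.2)%:E)^\- (t, z)))%E).
    by move=> t _; rewrite /KL [RHS]integralE; congr (_ - _)%E; apply: eq_integral => z _;
      rewrite ?funeposE ?funenegE.
  have := emeasurable_funB (mp _) (mn _); exact.
exact: (emeasurable_fun_infty_c (@measurable_Theta k) mKL).
Qed.

End truth.
End model_measurability.

(** * The estimator and the ratio B_n *)

Section order_estimator.
Context d (Z : measurableType d) {R : realType} (mu : {measure set Z -> \bar R}).
Variable M : model mu.
Variables (Pi : prior M) (ks : nat) (ts : 'rV[R]_(pdim M ks)).
Hypothesis Tts : Theta M ks ts.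
Local Notation B k := (borel_rV R (pdim M k)).

Lemma order_weight_le1 k : (0 < k)%N -> order_weight Pi k <= 1.
Proof.
move=> k0; rewrite -lee_fin -(order_weight_sum1 _ _ _ _ M Pi).
apply: (@le_trans _ _ (\sum_(1 <= j < k.+1) (order_weight Pi j)%:E)%E).
  rewrite big_nat_recr//= leeDr// sume_ge0// => j _.
  by rewrite lee_fin order_weight_ge0.
by apply: nneseries_lim_ge => j _ _; rewrite lee_fin order_weight_ge0.
Qed.

Lemma measurable_ratio_n_fst k n (zs : n.-tuple Z) :
  measurable_fun (Theta M k : set (B k))
    (fun t => (expR (loglik_n t zs - loglik_n ts zs))%:E).
Proof.
apply: (@measurable_comp _ _ _ _ _ _ ((Theta M k : set (B k)) `*` [set: n.-tuple Z])
  (fun x => (expR (loglik_n x.1 x.2 - loglik_n ts x.2))%:E) _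
  (fun t : B k => (t, zs))).
- by apply: measurableX => //; exact: measurable_Theta.
- by move=> _ [t Tt <-].
- by apply: measurable_ratio_n => //; exact: measurable_Theta.
- by apply: measurable_funTS; exact: measurable_pair2.
Qed.

Lemma evidenceE k n (zs : n.-tuple Z) :
  (evidence Pi k zs = (expR (loglik_n ts zs))%:E * Bn Pi ts k zs)%E.
Proof.
rewrite /evidence /Bn muleCA; congr *%E; rewrite -ge0_integralZl//.
- by apply: eq_integral => t _; rewrite -EFinM -expRD addrC subrK.
- exact: measurable_Theta.
- exact: measurable_ratio_n_fst.
Qed.

Lemma evidence_ge0 k n (zs : n.-tuple Z) : (0 <= evidence Pi k zs)%E.
Proof. by rewrite mule_ge0 ?lee_fin ?order_weight_ge0// integral_ge0. Qed.

Lemma measurable_Bn k n : measurable_fun setT (fun zs : n.-tuple Z => Bn Pi ts k zs).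
Proof.
apply: measurable_funeM; apply: measurable_posterior_mass => //.
exact: measurable_Theta.
Qed.

Lemma measurable_evidence k n :
  measurable_fun setT (fun zs : n.-tuple Z => evidence Pi k zs).
Proof.
apply: (eq_measurable_fun (fun zs : n.-tuple Z =>
    (expR (loglik_n ts zs))%:E * Bn Pi ts k zs))%E.
  by move=> zs _; rewrite evidenceE.
apply: emeasurable_funM; last exact: measurable_Bn.
apply/measurable_EFinP; apply: (measurableT_comp (@measurable_expR R)).
exact: measurable_loglik_n.
Qed.

Let total n (zs : n.-tuple Z) := (\sum_(1 <= j <oo) evidence Pi j zs)%E.

Let measurable_total n : measurable_fun setT (@total n).
Proof.
apply: (emeasurable_fun_cvg (fun N zs => \sum_(1 <= j < N) evidence Pi j zs)%E).
  by move=> N; apply: emeasurable_sum => j; exact: measurable_evidence.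
move=> zs _; apply: is_cvg_ereal_nneg_natsum => j _.
exact: evidence_ge0.
Qed.

Let evidence_le_total k n (zs : n.-tuple Z) : (0 < k)%N ->
  (evidence Pi k zs <= total zs)%E.
Proof.
move=> k0; apply: (@le_trans _ _ (\sum_(1 <= j < k.+1) evidence Pi j zs)%E).
  by rewrite big_nat_recr//= leeDr// sume_ge0// => j _; exact: evidence_ge0.
by apply: nneseries_lim_ge => j _ _; exact: evidence_ge0.
Qed.

(** The total evidence may be infinite. Its inverse is then 0 and all posteriors vanish, so a strict
    comparison of posteriors forces a finite total. *)
Let posterior_lt k n (zs : n.-tuple Z) :
  (posterior Pi k zs < posterior Pi k.+1 zs)%E <->
  (evidence Pi k zs < evidence Pi k.+1 zs)%E /\ (total zs < +oo)%E.
Proof.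
rewrite /posterior -/(total zs); split => [lt_post|[lt_ev tfin]].
  have [|] := eqVneq (total zs) +oo%E.
    by move=> ty; move: lt_post; rewrite ty invey !mule0 ltxx.
  rewrite -ltey => tfin; split => //; rewrite ltNge; apply/negP => le_ev.
  move: lt_post; apply/negP; rewrite -leNgt lee_wpmul2r// inve_ge0.
  exact: le_trans (evidence_ge0 k.+1 zs) (evidence_le_total _ _).
have t0 : (0 < total zs)%E.
  apply: lt_le_trans (evidence_le_total zs (ltn0Sn k)).
  exact: le_lt_trans (evidence_ge0 _ _) lt_ev.
have f0 : 0 < fine (total zs) by rewrite fine_gt0// t0.
have -> : (total zs)^-1%E = ((fine (total zs))^-1)%:E.
  by rewrite -[in LHS](@fineK _ (total zs)) ?ge0_fin_numE ?ltW// inver gt_eqF.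
by rewrite lte_pmul2r// lte_fin invr_gt0.
Qed.

Let order_est_gt n (zs : n.-tuple Z) :
  (ks%:R%:E < order_est Pi zs)%E <->
  forall k, (0 < k <= ks)%N -> (posterior Pi k zs < posterior Pi k.+1 zs)%E.
Proof.
split => [lt_est k /andP[k0 kks]|h].
  rewrite ltNge; apply/negP => le_post.
  have : (order_est Pi zs <= k%:R%:E)%E by apply: ereal_inf_lbound; exists k.
  by rewrite leNgt (le_lt_trans _ lt_est)// lee_fin ler_nat.
(* An infimum inherits only weak inequalities, hence the passage through the next integer. *)
apply: (@lt_le_trans _ _ ks.+1%:R%:E); first by rewrite lte_fin ltr_nat.
apply: le_ereal_inf_tmp => _ [k [k0 le_post] <-].
rewrite lee_fin ler_nat ltnNge; apply/negP => kks.
by have := h k; rewrite k0 kks ltNge le_post => /(_ isT).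
Qed.

(** Monotonicity of the law is applied to this event, so it has to be measurable; rewriting it with
    finitely many comparisons of evidences makes it so. *)
Lemma measurable_order_est_gt n :
  measurable [set zs : n.-tuple Z | (ks%:R%:E < order_est Pi zs)%E].
Proof.
rewrite (_ : [set _ | _] = \bigcap_k [set zs : n.-tuple Z | (0 < k <= ks)%N ->
    (evidence Pi k zs < evidence Pi k.+1 zs)%E /\ (total zs < +oo)%E]).
  apply: bigcapT_measurable => k.
  have [kks|kks] := boolP (0 < k <= ks)%N; last first.
    by rewrite (_ : [set _ | _] = setT)//; apply/seteqP; split.
  rewrite (_ : [set _ | _] = [set zs | (evidence Pi k zs < evidence Pi k.+1 zs)%E]
      `&` [set zs | (total zs < +oo)%E]); last first.
    by apply/seteqP; split => zs //= /(_ isT).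
  apply: measurableI.
    rewrite -[X in measurable X]setTI.
    by apply: measurable_lte => //; exact: measurable_evidence.
  by rewrite -[X in measurable X]setTI; exact: emeasurable_fun_infty_o.
apply/seteqP; split => zs /=.
  by move=> /order_est_gt h k _ /h /posterior_lt.
by move=> h; apply/order_est_gt => k kks; apply/posterior_lt; exact: h.
Qed.

(** Only the comparison of the orders [ks] and [ks.+1] is kept; dividing by the likelihood at the
    truth turns evidences into [Bn]. *)
Lemma order_est_gt_Bn n (zs : n.-tuple Z) :
  (ks%:R%:E < order_est Pi zs)%E -> (Bn Pi ts ks zs < Bn Pi ts ks.+1 zs)%E.
Proof.
move=> /order_est_gt/(_ ks); rewrite leqnn (Theta_gt0 Tts) => /(_ isT).
move=> /posterior_lt[+ _]; rewrite !evidenceE lte_pmul2l//.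
by rewrite lte_fin expR_gt0.
Qed.

End order_estimator.

(** * Uniform bounds on the likelihood ratio *)

Section exponential_moment.
Context d (T : measurableType d) {R : realType} (P : probability T R).

Lemma Rintegral_lincomb (X E Q : T -> R) (k0 k1 k2 k3 : R) :
  P.-integrable setT (EFin \o X) -> P.-integrable setT (EFin \o E) ->
  P.-integrable setT (EFin \o Q) ->
  (\int[P]_z (k0 + k1 * X z + k2 * E z + k3 * Q z)%:E =
   (k0 + k1 * (\int[P]_z X z) + k2 * (\int[P]_z E z) + k3 * (\int[P]_z Q z))%:E)%E.
Proof.
move=> iX iE iQ.
have iZ (k : R) (f : T -> R) : P.-integrable setT (EFin \o f) ->
    P.-integrable setT (EFin \o (fun z => k * f z)).
  by move=> /(integrableZl measurableT k); apply: eq_integrable.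
have iD (f g : T -> R) : P.-integrable setT (EFin \o f) ->
    P.-integrable setT (EFin \o g) -> P.-integrable setT (EFin \o (fun z => f z + g z)).
  by move=> if_ ig; have := integrableD measurableT if_ ig; apply: eq_integrable.
have ZE (k : R) (f : T -> R) : P.-integrable setT (EFin \o f) ->
    (\int[P]_z (k * f z)%:E = (k * (\int[P]_z f z))%:E)%E.
  move=> fi; under eq_integral do rewrite EFinM.
  by rewrite integralZl// EFinM /Rintegral fineK// integrable_fin_num.
have i0 : P.-integrable setT (EFin \o (fun z : T => k0)).
  exact: finite_measure_integrable_cst.
rewrite (@integralD_EFin _ _ _ _ _ _ (fun z => k0 + k1 * X z + k2 * E z)
  (fun z => k3 * Q z))//; [|by do 2 (apply: (iD); last exact: iZ)|exact: iZ].
rewrite (@integralD_EFin _ _ _ _ _ _ (fun z => k0 + k1 * X z)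
  (fun z => k2 * E z))//; [|by apply: iD; last exact: iZ|exact: iZ].
rewrite (@integralD_EFin _ _ _ _ _ _ (fun z => k0) (fun z => k1 * X z))//;
  last exact: iZ.
by rewrite !ZE// integral_cst// [X in (k0%:E * X)%E](@probability_setT _ _ _ P) mule1.
Qed.

(** Integrates [expRM_le], where exp X - 1 - X has mean at most e - x1. The coefficient [lam - k2]
    of X may have either sign: lam uses the upper bound x2 on the mean of X, and k2 the lower bound
    x1. *)
Lemma expectation_expRM_le (X Y : T -> R) (lam alpha a x1 x2 e m : R) :
  measurable_fun setT X -> measurable_fun setT Y -> (forall z, - X z <= Y z) ->
  0 <= lam <= 1 -> 0 <= alpha -> 0 <= a ->
  P.-integrable setT (EFin \o X) -> x1 <= (\int[P]_z X z) <= x2 ->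
  (\int[P]_z (expR (X z))%:E <= (1 + e)%:E)%E ->
  (\int[P]_z (Y z ^+ 2 * expR (alpha * Y z))%:E <= m%:E)%E ->
  (\int[P]_z (expR (lam * X z))%:E <=
   (1 + lam * x2 +
    lam ^+ 2 / 2 * ((a + 2) * (e - x1) + expR (- (alpha * a)) * m))%:E)%E.
Proof.
move=> mX mY XY l01 al0 a0 iX /andP[x1X Xx2] eX Qm; have /andP[l0 l1] := l01.
have mexp (f : T -> R) : measurable_fun setT f ->
    measurable_fun setT (fun z => expR (f z)).
  by move=> mf; exact: (measurableT_comp (@measurable_expR R)).
have mQ : measurable_fun setT (fun z => Y z ^+ 2 * expR (alpha * Y z)).
  by apply: measurable_funM; [exact: measurable_funX|
    apply: mexp; exact: measurable_funM].
have iE : P.-integrable setT (EFin \o (fun z => expR (X z))).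
  apply/integrableP; split; first by apply/measurable_EFinP; exact: mexp.
  under eq_integral do rewrite /= ger0_norm ?expR_ge0//.
  exact: le_lt_trans eX (ltry _).
have iQ : P.-integrable setT (EFin \o (fun z => Y z ^+ 2 * expR (alpha * Y z))).
  apply/integrableP; split; first by apply/measurable_EFinP.
  under eq_integral do
    rewrite /= ger0_norm ?(mulr_ge0 (sqr_ge0 _) (expR_ge0 _))//.
  exact: le_lt_trans Qm (ltry _).
have eX' : (\int[P]_z expR (X z)) <= 1 + e.
  by rewrite -lee_fin /Rintegral fineK//; exact: integrable_fin_num iE.
have Qm' : (\int[P]_z (Y z ^+ 2 * expR (alpha * Y z))) <= m.
  by rewrite -lee_fin /Rintegral fineK//; exact: integrable_fin_num iQ.
pose k2 := lam ^+ 2 / 2 * (a + 2); pose k3 := lam ^+ 2 / 2 * expR (- (alpha * a)).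
have k20 : 0 <= k2 by rewrite !mulr_ge0 ?sqr_ge0// addr_ge0.
have k30 : 0 <= k3 by rewrite !mulr_ge0 ?sqr_ge0 ?expR_ge0.
apply: (@le_trans _ _ (\int[P]_z (1 - k2 + (lam - k2) * X z + k2 * expR (X z) +
    k3 * (Y z ^+ 2 * expR (alpha * Y z)))%:E)%E).
  have le_z z : expR (lam * X z) <= 1 - k2 + (lam - k2) * X z + k2 * expR (X z) +
      k3 * (Y z ^+ 2 * expR (alpha * Y z)).
    apply: (le_trans (expRM_le l01 al0 a0 (XY z))).
    by rewrite le_eqVlt; apply/orP; left; apply/eqP; rewrite /k2 /k3; ring.
  apply: ge0_le_integral => //.
  - by apply/measurable_EFinP; apply: mexp; exact: measurable_funM.
  - apply/measurable_EFinP; apply: measurable_funD; last exact: measurable_funM.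
    apply: measurable_funD; last by apply: measurable_funM => //; exact: mexp.
    by apply: measurable_funD => //; exact: measurable_funM.
  - by move=> z _; rewrite lee_fin.
rewrite Rintegral_lincomb// lee_fin.
have := ler_wpM2l k20 eX'; have := ler_wpM2l k30 Qm'.
have := ler_wpM2l l0 Xx2; have := ler_wpM2l k20 x1X.
have -> : lam ^+ 2 / 2 * ((a + 2) * (e - x1) + expR (- (alpha * a)) * m) =
  k2 * (e - x1) + k3 * m by rewrite /k2 /k3; ring.
lra.
Qed.

End exponential_moment.

Section uniform_likelihood_bound.
Context d (Z : measurableType d) {R : realType} (mu : {measure set Z -> \bar R}).
Variable M : model mu.
Variables (ks : nat) (ts : 'rV[R]_(pdim M ks)).
Hypothesis Tts : Theta M ks ts.
Local Notation P := (law M ts).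
Variable k : nat.
Implicit Types G : set 'rV[R]_(pdim M k).

(** An exceptional event E replaces the event that the supremum over G exceeds c, which need not be
    measurable for an arbitrary G. In this form the bounds add up over unions of parameter sets. *)
Definition likelihood_le n G (c b : R) := exists E : set (n.-tuple Z),
  [/\ measurable E, (plaw P n E <= b%:E)%E &
      forall zs, ~ E zs -> forall t, G t ->
        expR (loglik_n t zs - loglik_n ts zs) <= c].

Lemma likelihood_leW n G G' c b b' : G `<=` G' -> b' <= b ->
  likelihood_le n G' c b' -> likelihood_le n G c b.
Proof.
move=> GG' bb' [E [mE Eb Ec]]; exists E; split => //.
  by rewrite (le_trans Eb)// lee_fin.
by move=> zs Ezs t /GG'; exact: Ec.
Qed.

Lemma likelihood_leU n G G' c b b' :
  likelihood_le n G c b -> likelihood_le n G' c b' ->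
  likelihood_le n (G `|` G') c (b + b').
Proof.
move=> [E [mE Eb Ec]] [E' [mE' Eb' Ec']]; exists (E `|` E'); split.
- exact: measurableU.
- by rewrite EFinD (le_trans (measureU2 _ mE mE'))// leeD.
- move=> zs /not_orP[nE nE'] t [Gt|Gt]; [exact: Ec|exact: Ec'].
Qed.

Lemma likelihood_le_seq (I : eqType) (s : seq I) n
    (G : I -> set 'rV[R]_(pdim M k)) c (b : I -> R) :
  (forall i, i \in s -> likelihood_le n (G i) c (b i)) ->
  likelihood_le n [set t | exists2 i, i \in s & G i t] c (\sum_(i <- s) b i).
Proof.
elim: s => [|i s IH] Gs.
  exists set0; split => //; first by rewrite measure0 big_nil.
  by move=> zs _ t [].
rewrite big_cons.
apply: (@likelihood_leW n _ (G i `|` [set t | exists2 i, i \in s & G i t]) c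
  (b i + \sum_(j <- s) b j)) => //.
  by move=> t [j]; rewrite inE => /predU1P[->|js] Gj; [left|right; exists j].
apply: likelihood_leU; first by apply: Gs; rewrite mem_head.
by apply: IH => j js; apply: Gs; rewrite inE js orbT.
Qed.

(** The product of the powers lam is compared with c itself rather than with c^lam: if c <= 1 and
    the likelihood ratio exceeds c, then so does its power lam, because a number below 1 grows under
    a power lam <= 1. *)
Lemma likelihood_le_chernoff n G (X : Z -> R) (lam c r : R) :
  measurable_fun setT X -> 0 <= lam <= 1 -> 0 < c <= 1 ->
  (forall t, G t -> forall z, loglik t z - loglik ts z <= X z) ->
  (\int[P]_z (expR (lam * X z))%:E <= r%:E)%E ->
  likelihood_le n G c (c^-1 * r ^+ n).
Proof.
move=> mX /andP[l0 l1] /andP[c0 c1] GX Xr.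
have mg : measurable_fun setT (fun z => expR (lam * X z)).
  by apply: (measurableT_comp (@measurable_expR R)); exact: measurable_funM.
exists [set zs : n.-tuple Z | c <= \prod_(i < n) expR (lam * X (tnth zs i))]; split.
- rewrite -[X in measurable X]setTI.
  rewrite (_ : [set zs | _] = (fun zs => \prod_(i < n) expR (lam * X (tnth zs i)))
    @^-1` `[c, +oo[).
    by apply: (@measurable_prod_tnth _ _ _ n _ mg).
  by apply/seteqP; split => zs /=; rewrite in_itv/= andbT.
- by apply: (@chernoff_prod _ _ _ P n _ r c mg) => // z; exact: expR_ge0.
- move=> zs /= /negP; rewrite -ltNge -expR_sum => hc t Gt.
  rewrite leNgt; apply/negP => cS; move: hc; apply/negP; rewrite -leNgt.
  have SX : loglik_n t zs - loglik_n ts zs <= \sum_(i < n) X (tnth zs i).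
    by rewrite -sumrB; apply: ler_sum => i _; exact: GX.
  rewrite -mulr_sumr; have [S0|S0] := leP 0 (loglik_n t zs - loglik_n ts zs).
    rewrite (le_trans c1)// -expR0 ler_expR mulr_ge0//.
    exact: le_trans SX.
  rewrite (le_trans (ltW cS))// ler_expR.
  apply: (@le_trans _ _ (lam * (loglik_n t zs - loglik_n ts zs))).
    by rewrite ler_niMl// ltW.
  by rewrite ler_wpM2l.
Qed.

End uniform_likelihood_bound.

(* No measurability: the integral of a nonnegative function is a supremum over
   the simple functions below it. *)
Lemma ge0_le_integralT d (T : measurableType d) (R : realType)
    (mu : {measure set T -> \bar R}) (f g : T -> \bar R) :
  (forall x, 0 <= f x)%E -> (forall x, f x <= g x)%E ->
  (\int[mu]_x f x <= \int[mu]_x g x)%E.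
Proof.
move=> f0 fg; rewrite !ge0_integralTE//; last by move=> x; exact: le_trans (fg x).
apply: le_ereal_sup => _ [h hf <-]; exists h => // x.
exact: le_trans (hf x) (fg x).
Qed.

Section integrability.
Context d (T : measurableType d) {R : realType} (P : probability T R).

Lemma integrable_of_sqr (f : T -> R) : measurable_fun setT f ->
  (\int[P]_z (f z ^+ 2)%:E < +oo)%E -> P.-integrable setT (EFin \o f).
Proof.
move=> mf f2.
have i1 : P.-integrable setT (EFin \o (fun z => 1 + f z ^+ 2)).
  have i2 : P.-integrable setT (EFin \o (fun z => f z ^+ 2)).
    apply/integrableP; split.
      by apply/measurable_EFinP; exact: measurable_funX.
    by under eq_integral do rewrite /= ger0_norm ?sqr_ge0//.
  have := integrableD measurableT (finite_measure_integrable_cst P 1 measurableT) i2.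
  by apply: eq_integrable.
apply: le_integrable i1 => //; first exact/measurable_EFinP.
move=> z _ /=; rewrite lee_fin [leRHS]ger0_norm ?addr_ge0 ?sqr_ge0//.
have : 0 <= (`|f z| - 1) ^+ 2 by exact: sqr_ge0.
have : 0 <= `|f z| by [].
by rewrite -(real_normK (num_real (f z))); nra.
Qed.

Lemma Rintegral_le_of_sqr (f : T -> R) (e : R) : 0 < e -> measurable_fun setT f ->
  (\int[P]_z (f z ^+ 2)%:E <= (e ^+ 2)%:E)%E -> (\int[P]_z f z) <= e.
Proof.
move=> e0 mf f2.
have i2 : P.-integrable setT (EFin \o (fun z => f z ^+ 2)).
  apply/integrableP; split.
    by apply/measurable_EFinP; exact: measurable_funX.
  under eq_integral do rewrite /= ger0_norm ?sqr_ge0//.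
  exact: le_lt_trans f2 (ltry _).
have i1 : P.-integrable setT (EFin \o f).
  by apply: integrable_of_sqr => //; exact: le_lt_trans f2 (ltry _).
have f2' : (\int[P]_z (f z ^+ 2)) <= e ^+ 2.
  by rewrite -lee_fin /Rintegral fineK//; exact: integrable_fin_num i2.
(* f <= (e + f^2 / e) / 2 *)
apply: (@le_trans _ _ (\int[P]_z (e / 2 + (2 * e)^-1 * f z ^+ 2))).
  apply: le_Rintegral => //.
    have i3 := integrableZl measurableT ((2 * e)^-1) i2.
    have := integrableD measurableT (finite_measure_integrable_cst P (e / 2) measurableT) i3.
    by apply: eq_integrable.
  move=> z _; rewrite -subr_ge0.
  have -> : e / 2 + (2 * e)^-1 * f z ^+ 2 - f z = (2 * e)^-1 * (f z - e) ^+ 2.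
    by field; rewrite gt_eqF.
  by rewrite mulr_ge0 ?sqr_ge0// invr_ge0 mulr_ge0// ltW.
have i0 : P.-integrable setT (EFin \o (fun _ : T => 0 : R)).
  exact: finite_measure_integrable_cst.
have := @Rintegral_lincomb _ _ _ P _ _ _ (e / 2) (2 * e)^-1 0 0 i2 i0 i0.
under eq_integral do rewrite !mul0r !addr0.
rewrite !mul0r !addr0 /Rintegral => -> /=.
move: f2'; rewrite /Rintegral => f2'.
have : (2 * e)^-1 * fine (\int[P]_z (f z ^+ 2)%:E)%E <= (2 * e)^-1 * e ^+ 2.
  by rewrite ler_wpM2l// invr_ge0 mulr_ge0// ltW.
have -> : (2 * e)^-1 * e ^+ 2 = e / 2 by field; rewrite gt_eqF.
lra.
Qed.

End integrability.

(** * Brackets on a shell around the truth *)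

Section brackets.
Context d (Z : measurableType d) {R : realType} (mu : {measure set Z -> \bar R}).
Variable M : model mu.
Variables (ks : nat) (ts : 'rV[R]_(pdim M ks)).
Hypothesis Tts : Theta M ks ts.
Local Notation P := (law M ts).

Lemma Vlog_truth (g : Z -> R) : measurable_fun setT g -> (forall z, 0 < g z) ->
  Vlog mu (edens ts) (EFin \o g) =
  (\int[P]_z ((loglik ts z - ln (g z)) ^+ 2)%:E)%E.
Proof.
move=> mg g0; rewrite (ge0_integral_law Tts).
- apply: eq_integral => z _; rewrite /edens /comp !lne_EFin ?dens_gt0// muleC.
  by rewrite -EFinB -EFin_expe.
- apply/measurable_EFinP; apply: measurable_funX; apply: measurable_funB.
    exact: measurable_loglik.
  exact: (measurableT_comp (@measurable_ln R)).
- by move=> z; rewrite lee_fin sqr_ge0.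
Qed.

Lemma integrable_loglikB k (t : 'rV[R]_(pdim M k)) : Theta M k t ->
  (Vlog mu (edens ts) (edens t) < +oo)%E ->
  P.-integrable setT (EFin \o (fun z => loglik ts z - loglik t z)).
Proof.
move=> Tt; rewrite (@Vlog_truth (dens M t)).
- apply: integrable_of_sqr; apply: measurable_funB; exact: measurable_loglik.
- exact: measurable_dens.
- by move=> z; exact: dens_gt0.
Qed.

(** Write X = ln u - ln f0 as D - Y with D = ln u - ln f_t and Y = ln f0 - ln f_t. The bracket gives
    0 <= E D <= delta / 4 and the shell gives delta <= E Y <= 2 delta, so E X lies between - 2 delta
    and - 3/4 delta. Moreover E exp X = mu(u) <= 1 + delta / 4, and 9/4 is 1/4 + 2. *)
Lemma bracket_expectation_le k (t : 'rV[R]_(pdim M k)) (l u : Z -> R)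
    (delta alpha m a lam : R) :
  Theta M k t -> is_bracket ts (delta / 4) l u ->
  (forall z, l z <= dens M t z <= u z) -> 0 < delta ->
  (delta%:E <= KL ts t <= (2 * delta)%:E)%E -> (qmom ts t alpha <= m%:E)%E ->
  0 <= alpha -> 0 <= a -> 0 <= lam <= 1 ->
  (\int[P]_z (expR (lam * (ln (u z) - loglik ts z)))%:E <=
   (1 - 3 / 4 * lam * delta +
    lam ^+ 2 / 2 * ((a + 2) * (9 / 4 * delta) + expR (- (alpha * a)) * m))%:E)%E.
Proof.
move=> Tt [lu [il iu] ul ul2 _] ltu d0 /andP[dKL KLd] qm al0 a0 l01.
have /andP[l0 l1] := l01.
have t0 z : 0 < dens M t z by exact: dens_gt0.
have u0 z : 0 < u z by have /andP[_] := ltu z; exact: lt_le_trans.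
have mu_ : measurable_fun setT u by move/measurable_int : iu => /measurable_EFinP.
have ml_ : measurable_fun setT l by move/measurable_int : il => /measurable_EFinP.
have mt := @measurable_loglik _ _ _ _ _ _ _ Tt.
have mts := @measurable_loglik _ _ _ _ _ _ _ Tts.
have mlnu : measurable_fun setT (fun z => ln (u z)).
  exact: (measurableT_comp (@measurable_ln R)).
pose Y z := loglik ts z - loglik t z.
pose D z := ln (u z) - loglik t z.
pose X z := ln (u z) - loglik ts z.
have D0 z : 0 <= D z.
  by rewrite subr_ge0 ler_ln ?posrE//; have /andP[] := ltu z.
have XE z : X z = D z - Y z by rewrite /X /D /Y; ring.
have mY : measurable_fun setT Y by exact: measurable_funB.
have mD : measurable_fun setT D by exact: measurable_funB.
have mX : measurable_fun setT X by exact: measurable_funB.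
have Q0 : (0 <= \int[P]_z (Y z ^+ 2 * expR (alpha * Y z))%:E)%E.
  by apply: integral_ge0 => z _; rewrite lee_fin mulr_ge0 ?sqr_ge0 ?expR_ge0.
have V0 : (0 <= Vlog mu (edens ts) (edens t))%E.
  rewrite (@Vlog_truth (dens M t))//; first by apply: integral_ge0 => z _; rewrite lee_fin sqr_ge0.
  exact: measurable_dens.
have Qm : (\int[P]_z (Y z ^+ 2 * expR (alpha * Y z))%:E <= m%:E)%E.
  by apply: le_trans qm; rewrite leeDl.
have iY : P.-integrable setT (EFin \o Y).
  apply: integrable_loglikB => //; apply: le_lt_trans (ltry m).
  by apply: le_trans qm; rewrite leeDr.
have D2 : (\int[P]_z (D z ^+ 2)%:E <= ((delta / 4) ^+ 2)%:E)%E.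
  apply: le_trans ul2; apply: ge0_le_integralT => z.
    by rewrite lee_fin sqr_ge0.
  have /andP[lt tu] := ltu z; have /andP[lz _] := lu z.
  (* The lower end l may vanish; the right-hand side is then +oo. *)
  rewrite (lne_EFin (u0 z)); move: lz; rewrite le_eqVlt => /predU1P[<-|lz].
    by rewrite le0_lneNy// addey// leey.
  rewrite (lne_EFin lz) -EFinB -EFin_expe lee_fin ler_sqr ?nnegrE//.
    by rewrite lerB// ler_ln ?posrE.
  by rewrite subr_ge0 ler_ln ?posrE// (le_trans lt).
have iD : P.-integrable setT (EFin \o D).
  by apply: integrable_of_sqr => //; exact: le_lt_trans D2 (ltry _).
have iX : P.-integrable setT (EFin \o X).
  have := integrableB measurableT iD iY; apply: eq_integrable => //.
  by move=> z _ /=; rewrite XE EFinB.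
have XI : (\int[P]_z X z) = (\int[P]_z D z) - (\int[P]_z Y z).
  rewrite -RintegralB//; apply: eq_Rintegral => z _; exact: XE.
have Dle : (\int[P]_z D z) <= delta / 4.
  by apply: Rintegral_le_of_sqr => //; rewrite divr_gt0.
have Dge : 0 <= (\int[P]_z D z).
  by apply: Rintegral_ge0 => z _; exact: D0.
have KLY : KL ts t = (\int[P]_z Y z)%:E.
  by rewrite /Rintegral fineK//; exact: integrable_fin_num iY.
move: dKL KLd; rewrite KLY !lee_fin => dY Yd.
have eX : (\int[P]_z (expR (X z))%:E <= (1 + delta / 4)%:E)%E.
  under eq_integral do rewrite expRB (lnK (u0 _)) (expR_loglik _ Tts).
  rewrite (expectation_loglik_ratio Tts)//; last by move=> z; exact: ltW.
  apply: (@le_trans _ _ (\int[mu]_z ((dens M t z)%:E + (u z - l z)%:E))%E).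
    apply: ge0_le_integralT => z; first by rewrite lee_fin ltW.
    by rewrite -EFinD lee_fin; have /andP[] := ltu z; lra.
  rewrite ge0_integralD//.
  - by rewrite integral_dens// EFinD leeD2l.
  - by move=> z _; rewrite lee_fin ltW.
  - by apply/measurable_EFinP; exact: measurable_dens.
  - by move=> z _; rewrite lee_fin subr_ge0; have /andP[] := lu z.
  - by apply/measurable_EFinP; exact: measurable_funB.
have XY z : - X z <= Y z by rewrite XE; have := D0 z; lra.
have x12 : - (2 * delta) <= (\int[P]_z X z) <= - (3 / 4 * delta).
  by rewrite XI; apply/andP; split; lra.
apply: (le_trans (expectation_expRM_le mX mY XY l01 al0 a0 iX x12 eX Qm)).
rewrite lee_fin le_eqVlt; apply/orP; left; apply/eqP; by field.
Qed.

End brackets.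

(* The choice a = (ln m - ln delta) / alpha makes the tail term equal to delta,
   and lam is then of order 1 / |ln delta|. *)
Lemma shell_rate {R : realType} (alpha m : R) : 0 < alpha -> 1 <= m ->
  exists2 K : R, 1 <= K & forall delta, 0 < delta <= expR (- K) ->
    exists a lam, [/\ 0 <= a, 0 <= lam <= 1 &
      1 - 3 / 4 * lam * delta +
      lam ^+ 2 / 2 * ((a + 2) * (9 / 4 * delta) + expR (- (alpha * a)) * m)
      <= expR (- (delta / (K * - ln delta)))].
Proof.
move=> al0 m1; have m0 : 0 < m by lra.
have lm : 0 <= ln m by exact: ln_ge0.
(* Chosen so that 9/4 (a + 2) + 1 <= K1 |ln delta| as soon as |ln delta| >= 1; 11/2 is 9/2 + 1. *)
pose K1 := 9 / 4 * ((ln m + 1) / alpha) + 11 / 2.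
have K15 : 11 / 2 <= K1.
  by rewrite lerDr mulr_ge0//; apply: divr_ge0; lra.
exists (4 * K1); first by lra.
move=> delta /andP[d0 dK]; set La := - ln delta.
have La1 : 1 <= La.
  rewrite /La lerNr -(expRK (- 1)) ler_ln ?posrE ?expR_gt0//.
  by rewrite (le_trans dK)// ler_expR; lra.
have La0 : 0 < La by lra.
have K10 : 0 < K1 by lra.
(* In units of delta / (K1 La), the two terms become - 3/8 and 1/8; their sum - 1/4 explains the
   final constant 4 K1. *)
pose lam := (2 * K1 * La)^-1; pose a := (ln m + La) / alpha.
have KL1 : 1 <= 2 * K1 * La by nra.
have KL0 : 0 < 2 * K1 * La by lra.
exists a, lam; split.
- by apply: divr_ge0; lra.
- by rewrite invr_ge0 (ltW KL0)/= invf_le1.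
have -> : expR (- (alpha * a)) * m = delta.
  rewrite /a mulrC [_ * (_ / alpha)]mulrC divfK ?gt_eqF// opprD expRD.
  by rewrite opprK expRN !lnK ?posrE// mulrA divff ?mul1r// gt_eqF.
apply: le_trans (expR_ge1Dx _).
have aK : 9 / 4 * (a + 2) + 1 <= K1 * La.
  have -> : K1 * La = 9 / 4 * ((ln m * La + La) / alpha) + 11 / 2 * La.
    by rewrite /K1; field; rewrite gt_eqF.
  have : a <= (ln m * La + La) / alpha.
    rewrite ler_pM2r ?invr_gt0// lerD2r ler_peMr//.
  lra.
have -> : - (delta / (4 * K1 * La)) =
    - (3 / 4) * lam * delta + lam ^+ 2 / 2 * (K1 * La * delta).
  by rewrite /lam; field; rewrite !gt_eqF.
have l20 : 0 <= lam ^+ 2 / 2 by rewrite mulr_ge0 ?sqr_ge0.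
rewrite -addrA lerD2l lerD ?mulNr// ler_wpM2l//.
have := ler_wpM2r (ltW d0) aK; lra.
Qed.

Section shells.
Context d (Z : measurableType d) {R : realType} (mu : {measure set Z -> \bar R}).
Variable M : model mu.
Variables (ks : nat) (ts : 'rV[R]_(pdim M ks)).
Hypothesis Tts : Theta M ks ts.

(** The infimum in [entropy] runs over integers, so it is attained unless no finite cover exists; in
    that case it is +oo, which the bound v excludes. *)
Lemma param_entropy_le k (G : set 'rV[R]_(pdim M k)) (delta v : R) :
  (param_entropy ts G delta <= v%:E)%E ->
  exists2 N : nat, bracket_cover ts (@dens _ _ _ _ M k @` G) delta N &
    N%:R <= expR v.
Proof.
rewrite /param_entropy /entropy.
set A := bracket_cover _ _ _; set I := ereal_inf _ => Iv.
have [N AN] : exists N, A N.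
  apply: contrapT => /forallNP nA; move: Iv; rewrite /I.
  rewrite (_ : [set _ | _ in _] = set0); first by rewrite ereal_inf0.
  by apply/seteqP; split => // x [N /nA].
have exA : exists N, `[< A N >] by exists N; exact/asboolP.
case: (ex_minnP exA) => N0 /asboolP AN0 minN0; exists N0 => //.
have N0I : (N0%:R%:E <= I)%E.
  by apply: le_ereal_inf_tmp => _ [N' AN' <-]; rewrite lee_fin ler_nat minN0//;
    exact/asboolP.
rewrite -lee_fin; apply: (le_trans N0I); rewrite leNgt; apply/negP => vI.
move: Iv; apply/negP; rewrite -ltNge -(@expeRK R v%:E) lte_lne//.
- by rewrite in_itv/= leey andbT lee_fin expR_ge0.
- by rewrite in_itv/= leey andbT (le_trans _ N0I)// lee_fin.
Qed.

Lemma likelihood_le_shell k n (G : set 'rV[R]_(pdim M k))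
    (delta alpha m K a lam c v : R) :
  G `<=` Theta M k ->
  (forall t, G t -> delta%:E <= KL ts t <= (2 * delta)%:E)%E ->
  (forall t, G t -> qmom ts t alpha <= m%:E)%E ->
  (param_entropy ts G (delta / 4) <= v%:E)%E ->
  0 < delta -> 0 <= alpha -> 0 <= a -> 0 <= lam <= 1 -> 0 < c <= 1 ->
  1 - 3 / 4 * lam * delta +
    lam ^+ 2 / 2 * ((a + 2) * (9 / 4 * delta) + expR (- (alpha * a)) * m)
    <= expR K ->
  likelihood_le ts n G c (c^-1 * expR (v + n%:R * K)).
Proof.
move=> GT GKL Gq /param_entropy_le[N [l [u [br cov]]] Nv] d0 al0 a0 l01 c01 hK.
have /andP[c0 c1] := c01.
pose Gi i := G `&` [set t | forall z, l i z <= dens M t z <= u i z].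
apply: (@likelihood_leW _ _ _ _ _ _ _ _ n _
  [set t | exists2 i, i \in enum 'I_N & Gi i t] c _
  (\sum_(i <- enum 'I_N) c^-1 * expR K ^+ n)).
- move=> t Gt; have [|i iz] := cov (dens M t); first by exists t.
  by exists i; rewrite ?mem_enum.
- rewrite big_enum/= sumr_const card_ord -mulrnAr ler_wpM2l ?invr_ge0 ?(ltW c0)//.
  rewrite expRD expRM_natl -mulr_natl ler_wpM2r// exprn_ge0// expR_ge0.
apply: likelihood_le_seq => i _.
(* A bracket without any density from G gets the empty event. The others need a point t0 of G, which
   provides the positivity of u and the bounds on the divergence. *)
have [[t0 [Gt0 lu0]]|Gi0] := pselect (Gi i !=set0); last first.
  exists set0; split => //.
    by rewrite measure0 lee_fin mulr_ge0 ?invr_ge0 ?exprn_ge0 ?expR_ge0// ltW.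
  by move=> zs _ t Gt; case: Gi0; exists t.
have Tt0 := GT _ Gt0.
have u0 z : 0 < u i z.
  by have /andP[_] := lu0 z; apply: lt_le_trans; exact: dens_gt0.
have [_ [_ /measurable_int/measurable_EFinP mui] _ _ _] := br i.
apply: (@likelihood_le_chernoff _ _ _ _ _ _ _ _ _ _ (fun z => ln (u i z) - loglik ts z) lam).
- apply: measurable_funB; last exact: measurable_loglik.
  exact: (measurableT_comp (@measurable_ln R)).
- exact: l01.
- exact: c01.
- move=> t [/GT Tt lu] z; rewrite lerD2r /loglik ler_ln ?posrE ?dens_gt0//.
  by have /andP[] := lu z.
- apply: (@le_trans _ _ (1 - 3 / 4 * lam * delta +
    lam ^+ 2 / 2 * ((a + 2) * (9 / 4 * delta) + expR (- (alpha * a)) * m))%:E).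
    apply: (@bracket_expectation_le _ _ _ _ _ _ _ Tts _ t0 (l i)) => //.
    + exact: GKL.
    + exact: Gq.
  by rewrite lee_fin.
Qed.

End shells.

(** * Envelopes of the log-likelihood *)

Section supremum_of_functions.
Context {R : realType} (n : nat) d (Z : measurableType d).
Variables (A : set 'rV[R]_n) (f : 'rV[R]_n -> Z -> R).
Hypothesis A0 : A !=set0.
Hypothesis cf : forall z, {within A, continuous (f ^~ z)}.
Hypothesis mf : forall t, A t -> measurable_fun setT (f t).
Hypothesis bf : forall z, has_ubound [set f t z | t in A].

Definition sup_on (z : Z) : R := sup [set f t z | t in A].

Lemma sup_on_ge t z : A t -> f t z <= sup_on z.
Proof. by move=> At; apply: ub_le_sup => //; exists t. Qed.

Lemma sup_on_le z y : (forall t, A t -> f t z <= y) -> sup_on z <= y.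
Proof.
move=> fy; apply: ge_sup; first by have [t At] := A0; exists (f t z), t.
by move=> _ [t At <-]; exact: fy.
Qed.

(** By continuity the supremum exceeds y exactly when some term along a countable dense sequence
    does. *)
Lemma measurable_sup_on : measurable_fun setT sup_on.
Proof.
have [s [sA sd]] := countable_dense_subset A0.
move=> _; apply: (measurability _ (RGenOInfty.measurableE R)) => //=.
move=> _ [_ [y ->] <-].
rewrite (_ : _ `&` _ = \bigcup_i (f (s i) @^-1` `]y, +oo[)).
  apply: bigcup_measurable => i _; rewrite -[X in measurable X]setTI.
  exact: mf.
apply/seteqP; split => [z [_]|z [i _]] /=; rewrite !in_itv/= !andbT; last first.
  by move=> yf; split => //; rewrite (lt_le_trans yf)// sup_on_ge.
move=> yU; have [t At yt] : exists2 t, A t & y < f t z.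
  apply: contrapT => h; move: yU; apply/negP; rewrite -leNgt.
  apply: sup_on_le => t At; rewrite leNgt; apply/negP => yt; apply: h.
  by exists t.
have e0 : 0 < f t z - y by rewrite subr_gt0.
have [r r0 rf] := within_continuous_ball (@cf z) At e0.
have [i ti] := sd t At r r0; exists i => //=; rewrite in_itv/= andbT.
by have := rf _ (sA i) ti; rewrite ltr_norml => /andP[_]; rewrite ltrD2l ltrN2.
Qed.

End supremum_of_functions.

Lemma compact_bounded_fun {R : realType} n (A : set 'rV[R]_n) (g : 'rV[R]_n -> R) :
  compact A -> {within A, continuous g} -> exists b : R, forall t, A t -> `|g t| <= b.
Proof.
move=> cA cg; have /compact_bounded[b [_ bP]] := continuous_compact cg cA.
by exists (b + 1) => t At; apply: (bP (b + 1)); [rewrite ltrDl|exists t].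
Qed.

Section envelopes.
Context d (Z : measurableType d) {R : realType} (mu : {measure set Z -> \bar R}).
Variable M : model mu.
Variable k : nat.
Local Notation param := 'rV[R]_(pdim M k).
Implicit Types (A : set param) (t : param).

(** Logarithms of the envelopes, finite by compactness of Theta k; [ereal_sup_edens] and
    [ereal_inf_edens] relate them to the extended real envelopes of (A2). The infimum is a negated
    supremum so that [sup_on] serves both. *)
Definition sup_loglik A : Z -> R := sup_on A (@loglik _ _ _ _ M k).
Definition inf_loglik A (z : Z) : R := - sup_on A (fun t z => - loglik t z) z.

Lemma loglik_bounded z : exists b : R, forall t, Theta M k t -> `|loglik t z| <= b.
Proof.
have [T0|/set0P[t0 /Theta_gt0 k0]] := eqVneq (Theta M k) set0.
  by exists 0 => t; rewrite T0.
apply: compact_bounded_fun; first exact: compact_Theta.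
exact: continuous_Theta_loglik.
Qed.

Section on_set.
Variable A : set param.
Hypotheses (A0 : A !=set0) (AT : A `<=` Theta M k).

Let ubl z : has_ubound [set loglik t z | t in A].
Proof.
have [b bP] := loglik_bounded z; exists b => _ [t /AT Tt <-].
by rewrite (le_trans (ler_norm _))// bP.
Qed.

Let ubN z : has_ubound [set - loglik t z | t in A].
Proof.
have [b bP] := loglik_bounded z; exists b => _ [t /AT Tt <-].
by rewrite (le_trans (ler_norm _))// normrN bP.
Qed.

Lemma sup_loglik_ge t z : A t -> loglik t z <= sup_loglik A z.
Proof. by move=> At; exact: sup_on_ge. Qed.

Lemma inf_loglik_le t z : A t -> inf_loglik A z <= loglik t z.
Proof. by move=> At; rewrite lerNl; exact: (@sup_on_ge _ _ _ _ _ (fun t z => - loglik t z)). Qed.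

Lemma sup_loglik_le z y : (forall t, A t -> loglik t z <= y) -> sup_loglik A z <= y.
Proof. exact: sup_on_le. Qed.

Lemma inf_loglik_ge z y : (forall t, A t -> y <= loglik t z) -> y <= inf_loglik A z.
Proof.
move=> h; rewrite lerNr; apply: sup_on_le => // t At; rewrite lerN2; exact: h.
Qed.

Let cl z : {within A, continuous (fun t => loglik t z)}.
Proof. exact: continuous_subspaceW AT (@continuous_Theta_loglik _ _ _ _ _ _ _). Qed.

Lemma measurable_sup_loglik : measurable_fun setT (sup_loglik A).
Proof. by apply: measurable_sup_on => // t /AT; exact: measurable_loglik. Qed.

Lemma measurable_inf_loglik : measurable_fun setT (inf_loglik A).
Proof.
apply: measurable_funN; apply: measurable_sup_on => //.
  by move=> z t; apply: cvgN; exact: cl.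
by move=> t /AT ?; apply: measurable_funN; exact: measurable_loglik.
Qed.

Lemma ereal_sup_edens z :
  ereal_sup [set edens t z | t in A] = (expR (sup_loglik A z))%:E.
Proof.
apply/eqP; rewrite eq_le; apply/andP; split.
  apply: ge_ereal_sup => _ [t At <-]; rewrite /edens -expR_loglik; last exact: AT.
  by rewrite lee_fin ler_expR sup_loglik_ge.
have ub t : A t -> ((expR (loglik t z))%:E <= ereal_sup [set edens t z | t in A])%E.
  move=> At; apply: ereal_sup_ubound; exists t => //.
  by rewrite /edens expR_loglik//; exact: AT.
case: ereal_sup ub => [r| |] ub; [|by rewrite leey|].
  have [t0 At0] := A0.
  have r0 : 0 < r.
    by have := ub _ At0; rewrite lee_fin; apply: lt_le_trans; exact: expR_gt0.
  rewrite lee_fin -[leRHS]lnK ?posrE// ler_expR; apply: sup_loglik_le => t At.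
  by rewrite -ler_expR lnK ?posrE//; have := ub _ At; rewrite lee_fin.
by have [t0 At0] := A0; have := ub _ At0.
Qed.

Lemma ereal_inf_edens z :
  ereal_inf [set edens t z | t in A] = (expR (inf_loglik A z))%:E.
Proof.
apply/eqP; rewrite eq_le; apply/andP; split; last first.
  apply: le_ereal_inf_tmp => _ [t At <-]; rewrite /edens -expR_loglik; last exact: AT.
  by rewrite lee_fin ler_expR inf_loglik_le.
have lb t : A t -> (ereal_inf [set edens t z | t in A] <= (expR (loglik t z))%:E)%E.
  move=> At; apply: ereal_inf_lbound; exists t => //.
  by rewrite /edens expR_loglik//; exact: AT.
case: ereal_inf lb => [r| |] lb; [|by have [t0 At0] := A0; have := lb _ At0|by rewrite leNye].
have [r0|r0] := leP r 0; first by rewrite lee_fin (le_trans r0)// expR_ge0.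
rewrite lee_fin -[leLHS]lnK ?posrE// ler_expR; apply: inf_loglik_ge => t At.
by rewrite -ler_expR lnK ?posrE//; have := lb _ At; rewrite lee_fin.
Qed.

End on_set.

End envelopes.

Lemma dominated_Rintegral d (T : measurableType d) {R : realType}
    (P : probability T R) (h : nat -> T -> R) (f g : T -> R) :
  (forall n, measurable_fun setT (h n)) -> measurable_fun setT f ->
  P.-integrable setT (EFin \o g) ->
  (forall n z, `|h n z| <= g z) -> (forall z, h n z @[n --> \oo] --> f z) ->
  (\int[P]_z h n z) @[n --> \oo] --> (\int[P]_z f z : R).
Proof.
move=> mh mf ig hg hf.
have mh' n : measurable_fun setT (EFin \o h n) by exact/measurable_EFinP.
have mf' : measurable_fun setT (EFin \o f) by exact/measurable_EFinP.
have hf' : {ae P, forall z, setT z -> (EFin \o h n) z @[n --> \oo] --> (EFin \o f) z}.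
  by apply: aeW => z _; apply: cvg_EFin; [exact: nearW|exact: hf].
have hg' : {ae P, forall z n, setT z -> (`|(EFin \o h n) z| <= (EFin \o g) z)%E}.
  by apply: aeW => z n _; rewrite lee_fin.
have [if_ _ cvgI] := dominated_convergence measurableT mh' mf' hf' ig hg'.
by apply: fine_cvg; rewrite fineK//; exact: integrable_fin_num if_.
Qed.

Lemma euclid_dist_ball (R : realType) n (t : 'rV[R]_n) (eta : R) : 0 < eta ->
  exists2 r : R, 0 < r & forall t', ball t r t' -> euclid_dist t t' < eta.
Proof.
(* Balls are those of the maximum norm. The divisor n + 1 instead of the square root of n gives a
   strict inequality and covers n = 0. *)
move=> e0; exists (eta / n.+1%:R); first by rewrite divr_gt0.
move=> t' tt'; rewrite /euclid_dist -[ltRHS]ger0_norm ?ltW// -sqrtr_sqr.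
rewrite ltr_sqrt ?exprn_gt0//.
apply: (@le_lt_trans _ _ (\sum_(i < n) (eta / n.+1%:R) ^+ 2)).
  apply: ler_sum => i _; rewrite -real_normK ?num_real// ler_sqr ?nnegrE//; last first.
    by rewrite divr_ge0// ltW.
  by move: tt' => [_ /(_ ord0 i)]; rewrite /ball/= => /ltW.
rewrite sumr_const card_ord expr_div_n -mulrnAr gtr_pMr ?exprn_gt0//.
rewrite -mulr_natl ltr_pdivrMr ?exprn_gt0// mul1r -natrX ltr_nat.
by rewrite -mulnn; apply: (@leq_trans n.+1) => //; rewrite leq_pmulr.
Qed.

(** * Small balls at a fixed distance from the truth *)

Section away_from_truth.
Context d (Z : measurableType d) {R : realType} (mu : {measure set Z -> \bar R}).
Variable M : model mu.
Variables (ks : nat) (ts : 'rV[R]_(pdim M ks)).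
Hypothesis Tts : Theta M ks ts.
Local Notation P := (law M ts).
Variable k : nat.
Implicit Types (t : 'rV[R]_(pdim M k)).

Section local.
Variable t : 'rV[R]_(pdim M k).
Hypothesis Tt : Theta M k t.
Variable eta : R.
Hypothesis eta0 : 0 < eta.
Hypothesis A2 : (Vlog mu (upper_env t eta) (edens ts) +
  Vlog mu (edens ts) (lower_env t eta) + Vlog mu (edens ts) (upper_env t eta)
  + Vlog mu (upper_env t eta) (edens t) < +oo)%E.

Let A := Theta M k `&` [set t' | euclid_dist t t' < eta].
Let AT : A `<=` Theta M k. Proof. by move=> ? []. Qed.
Let At : A t.
Proof.
split => //=; rewrite /euclid_dist big1 ?sqrtr0// => i _.
by rewrite subrr expr0n.
Qed.
Let A0 : A !=set0. Proof. by exists t. Qed.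
Let U := sup_loglik A.
Let L := inf_loglik A.
Let mU : measurable_fun setT U. Proof. exact: measurable_sup_loglik. Qed.
Let mL : measurable_fun setT L. Proof. exact: measurable_inf_loglik. Qed.
Let mts : measurable_fun setT (loglik ts). Proof. exact: measurable_loglik. Qed.

Let Vlog_ge0 (f g : Z -> \bar R) : (forall z, 0 <= f z)%E -> (0 <= Vlog mu f g)%E.
Proof.
move=> f0; apply: integral_ge0 => z _; rewrite mule_ge0//.
by rewrite sqre_ge0.
Qed.

Let edens_ge0 (s : 'rV[R]_(pdim M ks)) z : Theta M ks s -> (0 <= edens s z)%E.
Proof. by move=> Ts; rewrite lee_fin ltW// dens_gt0. Qed.

Let upperE : upper_env t eta = EFin \o (fun z => expR (U z)).
Proof. by apply/funext => z; exact: ereal_sup_edens. Qed.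

Let lowerE : lower_env t eta = EFin \o (fun z => expR (L z)).
Proof. by apply/funext => z; exact: ereal_inf_edens. Qed.

Let V4 : [/\ (Vlog mu (upper_env t eta) (edens ts) < +oo)%E,
  (Vlog mu (edens ts) (lower_env t eta) < +oo)%E &
  (Vlog mu (edens ts) (upper_env t eta) < +oo)%E].
Proof.
have v1 : (0 <= Vlog mu (upper_env t eta) (edens ts))%E.
  by apply: Vlog_ge0 => z; rewrite upperE lee_fin expR_ge0.
have v2 : (0 <= Vlog mu (edens ts) (lower_env t eta))%E.
  by apply: Vlog_ge0 => z; exact: edens_ge0.
have v3 : (0 <= Vlog mu (edens ts) (upper_env t eta))%E.
  by apply: Vlog_ge0 => z; exact: edens_ge0.
have v4 : (0 <= Vlog mu (upper_env t eta) (edens t))%E.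
  by apply: Vlog_ge0 => z; rewrite upperE lee_fin expR_ge0.
move: A2 v1 v2 v3 v4.
move: (Vlog mu (upper_env t eta) (edens ts)) (Vlog mu (edens ts) (lower_env t eta))
  (Vlog mu (edens ts) (upper_env t eta)) (Vlog mu (upper_env t eta) (edens t)).
move=> a b c e abce a0 b0 c0 e0; split; apply: le_lt_trans abce.
- by rewrite -!addeA leeDl// !adde_ge0.
- by rewrite -!addeA addeCA leeDl// !adde_ge0.
- by rewrite -!addeA [(b + _)%E]addeCA addeCA leeDl// !adde_ge0.
Qed.

Let mexp (f : Z -> R) : measurable_fun setT f ->
  measurable_fun setT (fun z => expR (f z)).
Proof. by move=> mf; exact: (measurableT_comp (@measurable_expR R)). Qed.

Let U2 : (\int[P]_z ((loglik ts z - U z) ^+ 2)%:E < +oo)%E.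
Proof.
have [_ _] := V4; rewrite upperE (Vlog_truth Tts); last 2 first.
- exact: mexp.
- by move=> z; exact: expR_gt0.
by under eq_integral do rewrite expRK.
Qed.

Let L2 : (\int[P]_z ((loglik ts z - L z) ^+ 2)%:E < +oo)%E.
Proof.
have [_ + _] := V4; rewrite lowerE (Vlog_truth Tts); last 2 first.
- exact: mexp.
- by move=> z; exact: expR_gt0.
by under eq_integral do rewrite expRK.
Qed.

Let iU : P.-integrable setT (EFin \o (fun z => loglik ts z - U z)).
Proof. by apply: integrable_of_sqr => //; exact: measurable_funB. Qed.

Let iL : P.-integrable setT (EFin \o (fun z => loglik ts z - L z)).
Proof. by apply: integrable_of_sqr => //; exact: measurable_funB. Qed.

(** Dominates every |ln f0 - h| with h between the two log-envelopes; integrable by (A2). *)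
Let g z := `|loglik ts z - U z| + `|loglik ts z - L z|.

Let ig : P.-integrable setT (EFin \o g).
Proof.
have := integrableD measurableT (integrable_norm iU) (integrable_norm iL).
by apply: eq_integrable.
Qed.

Let between_le_g (h : Z -> R) z : L z <= h z <= U z -> `|loglik ts z - h z| <= g z.
Proof.
move=> /andP[Lh hU]; rewrite /g; have := ler_norm (loglik ts z - L z).
have := ler_norm (- (loglik ts z - U z)); rewrite normrN => h1 h2.
have := normr_ge0 (loglik ts z - L z); have := normr_ge0 (loglik ts z - U z).
by rewrite ler_norml; lra.
Qed.

(* Where the envelope exceeds e times the true density, the squared log-ratio is
   at least 1. *)
Let eU : (\int[P]_z (expR (U z - loglik ts z))%:E < +oo)%E.
Proof.
under eq_integral do rewrite expRB (expR_loglik _ Tts).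
rewrite (expectation_loglik_ratio Tts) ?expR_ge0//; last exact: mexp.
have mV : measurable_fun setT (fun z => expR (U z) * (U z - loglik ts z) ^+ 2).
  apply: measurable_funM; first exact: mexp.
  by apply: measurable_funX; exact: measurable_funB.
have [+ _ _] := V4; rewrite upperE => VU.
apply: (@le_lt_trans _ _ (\int[mu]_z ((expR 1 * dens M ts z)%:E +
    (expR (U z) * (U z - loglik ts z) ^+ 2)%:E))%E).
  apply: ge0_le_integralT => z; first by rewrite lee_fin expR_ge0.
  rewrite -EFinD lee_fin -(expR_loglik z Tts).
  have q0 : 0 <= expR (U z) * (U z - loglik ts z) ^+ 2.
    by rewrite mulr_ge0 ?expR_ge0 ?sqr_ge0.
  have e0 : 0 <= expR 1 * expR (loglik ts z) by rewrite mulr_ge0 ?expR_ge0.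
  have [Ul|Ul] := leP (U z - loglik ts z) 1.
    rewrite -[leLHS]addr0 lerD// -expRD ler_expR; lra.
  rewrite -[leLHS]add0r lerD// ler_peMr ?expR_ge0// expr_ge1//; lra.
rewrite ge0_integralD//.
- rewrite lte_add_pinfty//.
    under eq_integral do rewrite EFinM.
    rewrite ge0_integralZl//.
    + by rewrite integral_dens// mule1 ltry.
    + by apply/measurable_EFinP; exact: measurable_dens.
    + by move=> z _; rewrite lee_fin ltW// dens_gt0.
  apply: le_lt_trans VU; apply: ge0_le_integralT => z.
    by rewrite lee_fin mulr_ge0 ?expR_ge0 ?sqr_ge0.
  rewrite /edens /comp !lne_EFin ?dens_gt0 ?expR_gt0// expRK.
  by rewrite -EFinB -EFin_expe -EFinM.
- by move=> z _; rewrite lee_fin mulr_ge0 ?expR_ge0// ltW// dens_gt0.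
- by apply/measurable_EFinP; apply: measurable_funM => //; exact: measurable_dens.
- by move=> z _; rewrite lee_fin mulr_ge0 ?expR_ge0 ?sqr_ge0.
- exact/measurable_EFinP.
Qed.

(** The set H > eps need not be compact, so the whole of Theta k will be covered, including balls
    that meet H <= eps. Shrinking the ball makes both log-envelopes tend to the log-density at t:
    the lower one then bounds H on the ball, the upper one provides the exponential bound. *)
Lemma local_dichotomy (eps : R) : 0 < eps -> exists2 r : R, 0 < r &
  (forall t', Theta M k t' -> ball t r t' -> (KL ts t' <= eps%:E)%E) \/
  (exists2 kappa : R, 0 < kappa & forall n c, 0 < c <= 1 ->
     likelihood_le ts n (Theta M k `&` ball t r) c
       (c^-1 * expR (- (kappa * n%:R)))).
Proof.
move=> eps0; have [r0 r00 r0A] := euclid_dist_ball t eta0.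
have rm0 m : 0 < r0 / m.+1%:R by rewrite divr_gt0.
pose A_ m := Theta M k `&` ball t (r0 / m.+1%:R).
have A_t m : A_ m t by split => //; exact: ballxx.
have A_0 m : A_ m !=set0 by exists t.
have A_T m : A_ m `<=` Theta M k by move=> ? [].
have A_A m : A_ m `<=` A.
  move=> t' [Tt' tt']; split => //; apply: r0A; apply: le_ball tt'.
  by rewrite ler_pdivrMr// ler_peMr ?ler1n// ltW.
pose U_ m := sup_loglik (A_ m); pose L_ m := inf_loglik (A_ m).
have mU_ m : measurable_fun setT (U_ m) by exact: measurable_sup_loglik.
have mL_ m : measurable_fun setT (L_ m) by exact: measurable_inf_loglik.
have mt := measurable_loglik Tt.
have LL_ m z : L z <= L_ m z.
  by apply: inf_loglik_ge => // t' /A_A; exact: inf_loglik_le.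
have U_U m z : U_ m z <= U z.
  by apply: sup_loglik_le => // t' /A_A; exact: sup_loglik_ge.
have L_t m z : L_ m z <= loglik t z by exact: inf_loglik_le.
have tU_ m z : loglik t z <= U_ m z by exact: sup_loglik_ge.
have close z e : 0 < e -> \forall m \near \oo,
    U_ m z <= loglik t z + e /\ loglik t z - e <= L_ m z.
  move=> e0; have [r rr rf] :=
    within_continuous_ball (@continuous_Theta_loglik _ _ _ _ M k z) Tt e0.
  have rr0 : 0 < r / r0 by rewrite divr_gt0.
  near=> m; have mr : r0 / m.+1%:R <= r.
    rewrite mulrC -ler_pdivlMr// ltW//.
    by near: m; exact: (near_infty_natSinv_lt (PosNum rr0)).
  by split; [apply: sup_loglik_le|apply: inf_loglik_ge] => // t' [Tt' tt'];
    have := rf t' Tt' (le_ball mr tt'); rewrite ltr_norml => /andP[]; lra.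
have cvgU : (\int[P]_z (U_ m z - loglik ts z)) @[m --> \oo] -->
    (\int[P]_z (loglik t z - loglik ts z) : R).
  apply: (dominated_Rintegral _ _ ig).
  - by move=> m; exact: measurable_funB.
  - exact: measurable_funB.
  - move=> m z; rewrite distrC; apply: between_le_g.
    by rewrite U_U (le_trans (LL_ m z))// (le_trans (L_t m z)).
  - move=> z; apply: cvgB; last exact: cvg_cst.
    apply/cvgrPdist_le => e e0; near=> m.
    have [Ue Le] : U_ m z <= loglik t z + e /\ loglik t z - e <= L_ m z.
      by near: m; exact: close.
    by rewrite ler_norml; have := tU_ m z; lra.
have cvgL : (\int[P]_z (loglik ts z - L_ m z)) @[m --> \oo] -->
    (\int[P]_z (loglik ts z - loglik t z) : R).
  apply: (dominated_Rintegral _ _ ig).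
  - by move=> m; exact: measurable_funB.
  - exact: measurable_funB.
  - move=> m z; apply: between_le_g.
    by rewrite LL_/= (le_trans (L_t m z))// (le_trans (tU_ m z)).
  - move=> z; apply: cvgB; first exact: cvg_cst.
    apply/cvgrPdist_le => e e0; near=> m.
    have [Ue Le] : U_ m z <= loglik t z + e /\ loglik t z - e <= L_ m z.
      by near: m; exact: close.
    by rewrite ler_norml; have := L_t m z; lra.
have igh (h : Z -> R) : measurable_fun setT h -> (forall z, L z <= h z <= U z) ->
    P.-integrable setT (EFin \o (fun z => loglik ts z - h z)).
  move=> mh hLU; apply: le_integrable ig => //.
    by apply/measurable_EFinP; exact: measurable_funB.
  move=> z _ /=; rewrite lee_fin (le_trans (between_le_g (hLU z)))//.
  exact: ler_norm.
have KLE t' : A t' -> KL ts t' = (\int[P]_z (loglik ts z - loglik t' z))%:E.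
  move=> At'; rewrite /KL /Rintegral fineK//.
  apply: (integrable_fin_num measurableT); apply: igh.
    by apply: measurable_loglik; exact: AT.
  by move=> z; rewrite inf_loglik_le ?sup_loglik_ge.
have [KLt|KLt] := ltP (\int[P]_z (loglik ts z - loglik t z)) eps.
  have [m _ /(_ _ (leqnn m)) /= mL'] : \forall m \near \oo,
      (\int[P]_z (loglik ts z - L_ m z)) < eps by exact: (cvgr_lt _ cvgL).
  exists (r0 / m.+1%:R) => //; left => t' Tt' tt'.
  have A_t' : A_ m t' by [].
  rewrite KLE ?lee_fin; last exact: A_A A_t'.
  apply: le_trans (ltW mL'); apply: le_Rintegral => //.
  - apply: igh; first exact: measurable_loglik.
    by move=> z; rewrite inf_loglik_le ?sup_loglik_ge//; exact: A_A A_t'.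
  - apply: igh => // z; rewrite LL_/= (le_trans (L_t m z))//.
    by rewrite (le_trans (tU_ m z)).
  - by move=> z _; rewrite lerD2l lerN2; exact: inf_loglik_le.
have KLN : (\int[P]_z (loglik t z - loglik ts z)) < - (eps / 2).
  have -> : (\int[P]_z (loglik t z - loglik ts z)) =
      - (\int[P]_z (loglik ts z - loglik t z)).
    rewrite -[RHS]mulN1r -RintegralZl//.
      by apply: eq_Rintegral => z _; rewrite mulN1r opprB.
    by apply: igh => // z; rewrite inf_loglik_le// sup_loglik_ge.
  lra.
have [m _ /(_ _ (leqnn m)) /= mU'] : \forall m \near \oo,
    (\int[P]_z (U_ m z - loglik ts z)) < - (eps / 2) by exact: (cvgr_lt _ cvgU).
exists (r0 / m.+1%:R) => //; right.
pose X z := U_ m z - loglik ts z; pose Y z := loglik ts z - L z.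
pose e := fine (\int[P]_z (expR (U z - loglik ts z))%:E)%E - 1.
pose m2 := fine (\int[P]_z (Y z ^+ 2)%:E)%E.
have iX : P.-integrable setT (EFin \o X).
  have /integrableN : P.-integrable setT (EFin \o (fun z => loglik ts z - U_ m z)).
    by apply: igh => // z; rewrite U_U (le_trans (LL_ m z))// (le_trans (L_t m z)).
  by apply: eq_integrable => // z _; rewrite /X /= opprB.
pose C := 2 * (e - (\int[P]_z X z)) + m2.
(* This makes lam C <= eps / 2, so the second-order term lam^2 C / 2 takes at most half of the
   first-order gain lam eps / 2. *)
pose lam := eps / (2 * (`|C| + eps)).
have C0 : 0 <= `|C| by [].
have lam0 : 0 < lam by rewrite divr_gt0// mulr_gt0// ltr_wpDl.
have lam1 : lam <= 1 by rewrite ler_pdivrMr; lra.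
exists (lam * eps / 4); first by rewrite divr_gt0// mulr_gt0.
move=> n c c01.
have Xle : (\int[P]_z (expR (lam * X z))%:E <= (expR (- (lam * eps / 4)))%:E)%E.
  have XY z : - X z <= Y z.
    by rewrite opprB lerD2l lerN2 (le_trans (LL_ m z))// (le_trans (L_t m z)).
  have mX : measurable_fun setT X by exact: measurable_funB.
  have mY : measurable_fun setT Y by exact: measurable_funB.
  have l01 : 0 <= lam <= 1 by rewrite ltW.
  have X12 : (\int[P]_z X z) <= (\int[P]_z X z) <= - (eps / 2).
    by rewrite lexx ltW.
  have Ee : (\int[P]_z (expR (X z))%:E <= (1 + e)%:E)%E.
    rewrite /e addrC subrK fineK; last first.
      by rewrite ge0_fin_numE//; apply: integral_ge0 => z _; rewrite lee_fin expR_ge0.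
    apply: ge0_le_integralT => z; first by rewrite lee_fin expR_ge0.
    by rewrite lee_fin ler_expR lerD2r.
  (* With alpha = a = 0 the exponential moment reduces to the second moment of ln f0 minus the lower
     log-envelope, which (A2) bounds. *)
  have Qm : (\int[P]_z (Y z ^+ 2 * expR (0 * Y z))%:E <= m2%:E)%E.
    under eq_integral do rewrite mul0r expR0 mulr1.
    rewrite /m2 fineK// ge0_fin_numE//.
    by apply: integral_ge0 => z _; rewrite lee_fin sqr_ge0.
  apply: (le_trans (expectation_expRM_le mX mY XY l01 (lexx 0) (lexx 0) iX X12 Ee Qm)).
  rewrite lee_fin; apply: le_trans (expR_ge1Dx _).
  rewrite mul0r oppr0 expR0 mul1r add0r -/C.
  have CE : lam * C <= eps / 2.
    apply: (@le_trans _ _ (lam * `|C|)); first by rewrite ler_wpM2l ?ler_norm// ltW.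
    rewrite /lam mulrAC ler_pdivrMr; last by lra.
    have : 0 <= eps * eps by rewrite mulr_ge0 ?ltW.
    lra.
  have := ler_wpM2l (ltW lam0) CE; lra.
rewrite -mulNr expRM_natr.
apply: (@likelihood_le_chernoff _ _ _ _ _ _ _ _ _ _ X lam) => //.
- exact: measurable_funB.
- by rewrite ltW.
- by move=> t' At' z; rewrite lerD2r; exact: sup_loglik_ge.
Unshelve. all: by end_near. Qed.

End local.
End away_from_truth.

(** * Compactness, divergence, and decomposition of the evidence *)

Section global.
Context d (Z : measurableType d) {R : realType} (mu : {measure set Z -> \bar R}).
Variable M : model mu.
Variables (ks : nat) (ts : 'rV[R]_(pdim M ks)).
Hypothesis Tts : Theta M ks ts.
Local Notation P := (law M ts).
Local Notation B k := (borel_rV R (pdim M k)).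

Lemma exists_lower_bound (I : eqType) (s : seq I) (f : I -> R) :
  (forall i, i \in s -> 0 < f i) -> exists2 y : R, 0 < y & forall i, i \in s -> y <= f i.
Proof.
elim: s => [|i s IH] f0; first by exists 1.
have [|y y0 yf] := IH; first by move=> j js; apply: f0; rewrite inE js orbT.
exists (Num.min (f i) y); first by rewrite lt_min y0 f0// mem_head.
move=> j; rewrite inE => /predU1P[->|js]; first by rewrite ge_min lexx.
by rewrite ge_min yf ?orbT.
Qed.

Lemma likelihood_le_far k (eps : R) : condA2 ts -> 0 < eps ->
  exists2 C : R, 0 <= C & exists2 kappa : R, 0 < kappa & forall n c, 0 < c <= 1 ->
    likelihood_le ts n [set t | Theta M k t /\ (eps%:E < KL ts t)%E] c
      (C * (c^-1 * expR (- (kappa * n%:R)))).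
Proof.
move=> A2 eps0.
have [T0|/set0P[t0 /Theta_gt0 k0]] := eqVneq (Theta M k) set0.
  exists 0 => //; exists 1 => // n c _; exists set0; split => //.
    by rewrite measure0 mul0r.
  by move=> zs _ t [+ _]; rewrite T0.
(* Intersecting with H > eps empties the balls of the first alternative, for which any kappa will
   do; the radius is chosen first because the finite subcover depends on it, then kappa. *)
have /choice[r rP] (t : 'rV[R]_(pdim M k)) : exists r : R, Theta M k t -> 0 < r /\
    exists2 kappa : R, 0 < kappa & forall n c, 0 < c <= 1 ->
      likelihood_le ts n
        (Theta M k `&` ball t r `&` [set t | (eps%:E < KL ts t)%E]) c
        (c^-1 * expR (- (kappa * n%:R))).
  have [Tt|nTt] := pselect (Theta M k t); last by exists 0.
  have [eta eta0 A2t] := A2 k t k0 Tt.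
  have [r r0 [rle|[kappa kappa0 rk]]] := local_dichotomy Tts Tt eta0 A2t eps0.
    exists r => _; split => //; exists 1 => // n c /andP[c0 c1].
    exists set0; split => //.
      by rewrite measure0 lee_fin mulr_ge0 ?expR_ge0 ?invr_ge0 ?ltW.
    by move=> zs _ t' [[Tt' tt']] /=; rewrite ltNge rle.
  exists r => _; split => //; exists kappa => // n c c01.
  by apply: likelihood_leW (rk n c c01) => // t' [].
have := compact_Theta _ _ _ _ M k k0; rewrite compact_cover.
move=> /(_ _ (Theta M k) (fun t => ball t (r t))) [].
- by move=> t Tt; apply: ball_open; have [] := rP t Tt.
- by move=> t Tt; exists t => //; apply: ballxx; have [] := rP t Tt.
move=> D DT cov.
have /choice[kap kapP] (t : 'rV[R]_(pdim M k)) : exists kappa : R, Theta M k t ->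
    0 < kappa /\ forall n c, 0 < c <= 1 ->
      likelihood_le ts n
        (Theta M k `&` ball t (r t) `&` [set t | (eps%:E < KL ts t)%E]) c
        (c^-1 * expR (- (kappa * n%:R))).
  have [Tt|nTt] := pselect (Theta M k t); last by exists 0.
  by have [_ [kappa ? ?]] := rP t Tt; exists kappa.
have DTheta t : t \in finmap.enum_fset D -> Theta M k t by move=> /DT; rewrite inE.
have [|y y0 yk] := @exists_lower_bound _ (finmap.enum_fset D) kap.
  by move=> t /DTheta /kapP[].
exists (size (finmap.enum_fset D))%:R => //; exists y => // n c c01.
have /andP[c0 _] := c01.
apply: (@likelihood_leW _ _ _ _ _ _ _ _ n _ [set t | exists2 i, i \in finmap.enum_fset D &
  (Theta M k `&` ball i (r i) `&` [set t | (eps%:E < KL ts t)%E]) t] c _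
  (\sum_(i <- finmap.enum_fset D) c^-1 * expR (- (y * n%:R)))).
- move=> t [Tt KLt]; have [i /= Di it] := cov t Tt; exists i => //.
- by rewrite big_const_seq count_predT iter_addr_0 mulr_natl.
apply: likelihood_le_seq => i iD.
have [_ /(_ n c c01)] := kapP i (DTheta i iD).
apply: likelihood_leW => //; rewrite ler_wpM2l ?invr_ge0 ?(ltW c0)// ler_expR.
by rewrite lerN2 ler_wpM2r// yk.
Qed.

(** Follows from 1 - Y <= exp (- Y) with Y the log-ratio. As Y may fail to be integrable, the
    inequality is integrated as 1 + Y^- <= exp (- Y) + Y^+, and the integral of Y^- is finite
    because Y^- <= exp (- Y). *)
Lemma KL_ge0 k (t : 'rV[R]_(pdim M k)) : Theta M k t -> (0 <= KL ts t)%E.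
Proof.
move=> Tt; rewrite /KL integralE.
set Y := fun z => (loglik ts z - loglik t z)%:E.
have mY : measurable_fun setT Y.
  by apply/measurable_EFinP; apply: measurable_funB; exact: measurable_loglik.
have mp := measurable_funepos mY; have mn := measurable_funeneg mY.
have me : measurable_fun setT (fun z => (expR (loglik t z - loglik ts z))%:E).
  apply/measurable_EFinP; apply: (measurableT_comp (@measurable_expR R)).
  exact: measurable_loglikB.
have e0 z : (0 <= (expR (loglik t z - loglik ts z))%:E)%E by rewrite lee_fin expR_ge0.
have : (\int[P]_z (1 + Y^\- z) <=
        \int[P]_z ((expR (loglik t z - loglik ts z))%:E + Y^\+ z))%E.
  apply: ge0_le_integralT => z; first by rewrite adde_ge0.
  rewrite funeposE funenegE /Y -EFinN -!EFin_max -!EFinD lee_fin opprB.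
  have x1 := expR_ge1Dx (loglik t z - loglik ts z).
  move: x1; set x := loglik t z - loglik ts z.
  have -> : loglik ts z - loglik t z = - x by rewrite opprB.
  by move=> x1; rewrite /Num.max; case: ltP => ?; case: ltP => ?; lra.
rewrite ge0_integralD//.
rewrite ge0_integralD// integral_cst// [X in (1 * X)%E](@probability_setT _ _ _ P) mule1.
rewrite expectation_ratio// => h.
have fn : (\int[P]_z Y^\- z)%E \is a fin_num.
  rewrite ge0_fin_numE ?integral_ge0//.
  apply: (@le_lt_trans _ _ 1%E); last exact: ltry.
  rewrite -(expectation_ratio Tts Tt); apply: ge0_le_integralT => // z.
  rewrite funenegE /Y -EFinN -EFin_max lee_fin opprB ge_max expR_ge0 andbT.
  by apply: le_trans (expR_ge1Dx _); rewrite lerDr.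
rewrite sube_ge0 ?fn ?orbT//.
by move: h; rewrite leeD2lE.
Qed.

Lemma KL_incl : KL ts (Defs.incl M ts) = 0%E.
Proof.
rewrite /KL (eq_integral (cst 0%E)) ?integral0// => z _.
by rewrite /loglik dens_incl// subrr.
Qed.

Lemma KLinf_next : KLinf ts ks.+1 = 0%E.
Proof.
apply/eqP; rewrite eq_le; apply/andP; split.
  rewrite -KL_incl; apply: ereal_inf_lbound; exists (Defs.incl M ts) => //.
  exact: Defs.incl_Theta.
by apply: le_ereal_inf_tmp => _ [t Tt <-]; exact: KL_ge0.
Qed.

(** [KL_set] halves its argument and the infimum is 0 at this order, so the shells of the entropy
    condition are the slices j delta < H <= (j + 1) delta. *)
Lemma KL_set_next (delta : R) : KL_set M ts ks.+1 (2 * delta) =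
  [set t | Theta M ks.+1 t /\ (KL ts t <= delta%:E)%E].
Proof.
by rewrite /KL_set KLinf_next add0e [2 * delta]mulrC mulfK ?pnatr_eq0.
Qed.

(** The event implies B_n(ks) < B_n(ks + 1). If B_n(ks) >= 3 c, then one of the integrals over H <=
    delta, over the rest outside F and over the rest of F exceeds c. Off E the last one cannot: the
    integrand is at most c and the prior is a probability. *)
Lemma order_est_gt_le (Pi : prior M) n (F : set (B ks.+1)) (delta c b : R) :
  measurable F -> F `<=` Theta M ks.+1 -> 0 < c ->
  likelihood_le ts n (F `&` [set t | (delta%:E < KL ts t)%E]) c b ->
  (plaw P n [set zs | (ks%:R%:E < order_est Pi zs)%E] <=
   plaw P n [set zs | (Bn Pi ts ks zs < (3 * c)%:E)%E] +
   c^-1%:E * prior_k Pi ks.+1 [set t | Theta M ks.+1 t /\ (KL ts t <= delta%:E)%E] +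
   c^-1%:E * prior_k Pi ks.+1 (Theta M ks.+1 `\` F) + b%:E)%E.
Proof.
move=> mF FT c0 [E [mE Eb Ec]].
set T := Theta M ks.+1; set pi := prior_k Pi ks.+1.
pose A1 : set (B ks.+1) := [set t | T t /\ (KL ts t <= delta%:E)%E].
pose A2 : set (B ks.+1) := (T `\` F) `\` A1.
pose A3 : set (B ks.+1) := F `\` A1.
have mT : measurable (T : set (B ks.+1)) by exact: measurable_Theta.
have mA1 : measurable A1 by exact: measurable_KL_le.
have mA2 : measurable A2 by apply: measurableD => //; exact: measurableD.
have mA3 : measurable A3 by exact: measurableD.
pose I A (zs : n.-tuple Z) :=
  (\int[pi]_(t in A) (expR (loglik_n t zs - loglik_n ts zs))%:E)%E.
have T123 : (T : set (B ks.+1)) = A1 `|` (A2 `|` A3).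
  apply/seteqP; split => [t Tt|t [[]|[[[]]|[/FT]]]]//.
  have [|nA1] := pselect (A1 t); first by left.
  by right; have [Ft|nF] := pselect (F t); [right|left].
have mI (A : set (B ks.+1)) (zs : n.-tuple Z) : measurable A -> A `<=` T -> measurable_fun A
    (fun t : B ks.+1 => (expR (loglik_n t zs - loglik_n ts zs))%:E).
  move=> mA AT; apply: measurable_funS (@measurable_ratio_n_fst _ _ _ _ M _ _ Tts _ n zs) => //.
have IE zs : I T zs = (I A1 zs + (I A2 zs + I A3 zs))%E.
  rewrite /I [in LHS]T123 ge0_integral_setU//.
  - congr +%E; rewrite ge0_integral_setU//.
    + apply: mI; first exact: measurableU.
      by move=> t [[[]]|[/FT]].
    + by apply/disj_setPRL => t [Ft _] [[_ nF] _].
  - exact: measurableU.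
  - by rewrite -T123; exact: mI.
  - by apply/disj_setPRL => t [[_ nA1]|[_ nA1]].
have Bn_le zs : (Bn Pi ts ks.+1 zs <= I T zs)%E.
  rewrite /Bn -[leRHS]mul1e; apply: lee_wpmul2r; first exact: integral_ge0.
  by rewrite lee_fin order_weight_le1.
pose S0 := [set zs : n.-tuple Z | (Bn Pi ts ks zs < (3 * c)%:E)%E].
pose S1 := [set zs : n.-tuple Z | (c%:E <= I A1 zs)%E].
pose S2 := [set zs : n.-tuple Z | (c%:E <= I A2 zs)%E].
have mS0 : measurable S0.
  by rewrite -[X in measurable X]setTI; apply: emeasurable_fun_infty_o => //;
    exact: measurable_Bn.
have mIA (A : set (B ks.+1)) : measurable A -> A `<=` T ->
    measurable [set zs : n.-tuple Z | (c%:E <= I A zs)%E].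
  move=> mA AT; rewrite -[X in measurable X]setTI; apply: emeasurable_fun_c_infty => //.
  exact: measurable_posterior_mass.
have mS1 : measurable S1 by apply: mIA => // t [].
have mS2 : measurable S2 by apply: mIA => // t [[]].
have sub : [set zs : n.-tuple Z | (ks%:R%:E < order_est Pi zs)%E] `<=`
    S0 `|` S1 `|` S2 `|` E.
  move=> zs /(order_est_gt_Bn Tts) ltB.
  apply: contrapT => /not_orP[/not_orP[/not_orP[nS0 nS1] nS2] nE].
  move: nS0 nS1 nS2 => /negP + /negP + /negP; rewrite -leNgt -!ltNge => h0 h1 h2.
  have h3 : (I A3 zs <= c%:E)%E.
    apply: (@le_trans _ _ (\int[pi]_(t in A3) (cst c%:E) t)%E).
      apply: ge0_le_integral => //.
      - by apply: mI => // t [/FT].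
      - move=> t [Ft nA1]; rewrite lee_fin; apply: Ec => //; split => //=.
        by rewrite ltNge; apply/negP => ?; apply: nA1; split => //; exact: FT.
    rewrite integral_cst// -[leRHS]mule1; apply: lee_wpmul2l.
      by rewrite lee_fin ltW.
    exact: probability_le1.
  move: ltB; apply/negP; rewrite -leNgt; apply: le_trans h0.
  apply: (le_trans (Bn_le zs)); rewrite IE.
  have -> : (3 * c)%:E = (c%:E + (c%:E + c%:E))%E by rewrite -!EFinD; congr EFin; ring.
  by apply: leeD; [exact: ltW|apply: leeD => //; exact: ltW].
apply: (le_trans (le_measure (plaw P n) _ _ sub)).
- by apply/mem_set; exact: (measurable_order_est_gt Pi Tts).
- by rewrite inE; do 3 (apply: measurableU => //).
apply: (le_trans (measureU2 _ _ mE)); first by do 2 (apply: measurableU => //).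
rewrite leeD//; apply: (le_trans (measureU2 _ _ mS2)); first exact: measurableU.
rewrite leeD//.
  apply: (le_trans (measureU2 _ mS0 mS1)); rewrite leeD//.
  by apply: posterior_mass_ge => // t [].
apply: (le_trans (@posterior_mass_ge _ _ _ _ _ _ _ Tts _ n pi A2 c mA2 _ c0)).
  by move=> t [[]].
rewrite lee_wpmul2l ?lee_fin ?invr_ge0 ?(ltW c0)//.
by apply: le_measure; rewrite ?inE//; [exact: measurableD|move=> t []].
Qed.

End global.

(** * Summation over the shells *)

Section near_truth.
Context d (Z : measurableType d) {R : realType} (mu : {measure set Z -> \bar R}).
Variable M : model mu.
Variables (ks : nat) (ts : 'rV[R]_(pdim M ks)).
Hypothesis Tts : Theta M ks ts.

Lemma exists_slice (x y : R) : 0 < y < x ->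
  exists2 j, (0 < j)%N & j%:R * y < x <= j.+1%:R * y.
Proof.
move=> /andP[y0 yx].
have exi : exists i : nat, x <= i%:R * y.
  exists (Num.bound (x / y)); rewrite -ler_pdivrMr// ltW// archi_boundP//.
  by rewrite divr_ge0// ltW// (lt_trans y0).
case: (ex_minnP exi) => -[|[|j]] xj minj.
- by move: xj; rewrite mul0r leNgt (lt_trans y0).
- by move: xj; rewrite mul1r leNgt yx.
exists j.+1 => //; rewrite xj andbT ltNge; apply/negP => /minj.
by rewrite ltnn.
Qed.

(** With q = n D / (2 K |ln D|), the gain on a shell is 2 q and the entropy at most q. What is left
    is at least n delta / (2 K ln n), since D >= delta and |ln D| <= ln n; the factor n counts the
    shells. *)
Lemma likelihood_le_near n (F : set 'rV[R]_(pdim M ks.+1))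
    (alpha dbar m K s C delta eps c : R) :
  (forall delta, 0 < delta <= expR (- K) ->
    exists a lam, [/\ 0 <= a, 0 <= lam <= 1 &
      1 - 3 / 4 * lam * delta +
      lam ^+ 2 / 2 * ((a + 2) * (9 / 4 * delta) + expR (- (alpha * a)) * m)
      <= expR (- (delta / (K * - ln delta)))]) -> 1 <= K ->
  condA1_at ts ks.+1 alpha dbar m -> F `<=` Theta M ks.+1 ->
  0 < s -> 0 <= C -> eps <= dbar / 4 -> eps <= expR (- K) -> 0 < c <= 1 ->
  1 < n%:R :> R -> n%:R^-1 <= delta ->
  (forall j, (0 < j)%N -> j%:R * delta <= eps ->
    (param_entropy ts (F `&` (KL_set M ts ks.+1 (2 * j.+1%:R * delta)
                        `\` KL_set M ts ks.+1 (2 * j%:R * delta)))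
       (j%:R * delta / 4)
     <= (s / (1 + s) * (n%:R * j%:R * delta
            / (64 * (C + 2) * ln (j%:R * delta) ^+ 2)))%:E)%E) ->
  likelihood_le ts n
    (F `&` [set t | (delta%:E < KL ts t <= eps%:E)%E]) c
    (n%:R * (c^-1 * expR (- (n%:R * delta / (2 * K * ln n%:R))))).
Proof.
move=> rate K1 [al0 dbar0 m1 A1] FT s0 C0 epsd epsK c01 n1 nd ent.
have /andP[c0 c1] := c01.
have n0 : 0 < n%:R :> R by lra.
have d0 : 0 < delta by apply: lt_le_trans nd; rewrite invr_gt0.
(* Slices starting beyond eps carry no entropy bound, so they are made empty. *)
pose G j := [set t | j%:R * delta <= eps /\
  (F `&` (KL_set M ts ks.+1 (2 * j.+1%:R * delta)
          `\` KL_set M ts ks.+1 (2 * j%:R * delta))) t].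
have eps1 : eps < 1.
  by apply: (le_lt_trans epsK); rewrite expR_lt1; lra.
apply: (@likelihood_leW _ _ _ _ _ _ _ _ n _
  [set t | exists2 j, j \in iota 1 n & G j t] c _
  (\sum_(j <- iota 1 n) c^-1 * expR (- (n%:R * delta / (2 * K * ln n%:R))))).
- move=> t [Ft /= /andP[dt te]].
  have [x xE] : exists x, KL ts t = x%:E.
    by case: (KL ts t) dt te => [x| |]//; exists x.
  move: dt te; rewrite xE !lte_fin !lee_fin => dx xe.
  have [|j j0 /andP[jx xj]] := @exists_slice x delta; first by rewrite d0.
  exists j.
    (* At most n slices matter: j delta < 1 and delta >= 1/n. *)
    rewrite mem_iota j0/= add1n ltnS -(ler_nat R).
    have : j%:R * delta < 1 by lra.
    rewrite -ltr_pdivlMr// mul1r => jd; rewrite ltW// (lt_le_trans jd)//.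
    by rewrite -[leRHS]invrK lef_pV2 ?posrE ?invr_gt0.
  split; first lra.
  split => //; rewrite -!mulrA !KL_set_next//; split => /=.
    by split; [exact: FT|rewrite xE lee_fin].
  by move=> [_]; rewrite xE lee_fin leNgt jx.
- by rewrite big_const_seq count_predT iter_addr_0 size_iota [leRHS]mulr_natl.
apply: likelihood_le_seq => j; rewrite mem_iota => /andP[j0 _].
have j1 : 1 <= j%:R :> R by rewrite ler1n.
have [je|je] := leP (j%:R * delta) eps; last first.
  exists set0; split => //.
    by rewrite measure0 lee_fin mulr_ge0 ?expR_ge0 ?invr_ge0 ?ltW.
  by move=> zs _ t [+ _]; rewrite leNgt je.
set D := j%:R * delta.
have dD : delta <= D by rewrite ler_peMl// ltW.
have D0 : 0 < D by lra.
have De : D <= eps := je.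
have DK : D <= expR (- K) by exact: le_trans je epsK.
have [|a [lam [a0 l01 hK]]] := rate D; first by rewrite D0.
have LaK : K <= - ln D by rewrite lerNr -[leRHS]expRK ler_ln ?posrE ?expR_gt0.
have La0 : 0 < - ln D by lra.
have LaN : - ln D <= ln n%:R.
  rewrite -lnV ?posrE// ler_ln ?posrE ?invr_gt0// -[leRHS]invrK.
  by rewrite lef_pV2 ?posrE ?invr_gt0// (le_trans nd).
have ln0 : 0 < ln n%:R :> R by lra.
have GE t : G j t -> [/\ Theta M ks.+1 t, F t & (D%:E < KL ts t <= (j.+1%:R * delta)%:E)%E].
  rewrite /G/= -!mulrA !KL_set_next// => -[_ [Ft [[Tt tj] nt]]]; split => //.
  by rewrite tj andbT ltNge; apply/negP => ?; apply: nt; split.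
have D2 : j.+1%:R * delta <= 2 * D.
  by rewrite /D mulrA ler_wpM2r ?(ltW d0)// -natr1; lra.
apply: (@likelihood_leW _ _ _ _ _ _ _ _ n _ (G j) c _
  (c^-1 * expR (s / (1 + s) * (n%:R * j%:R * delta
            / (64 * (C + 2) * ln D ^+ 2)) + n%:R * - (D / (K * - ln D))))) => //.
  rewrite ler_wpM2l ?invr_ge0 ?(ltW c0)// ler_expR.
  have nD0 : 0 < n%:R * D by rewrite mulr_gt0.
  (* K |ln D| <= ln^2 D because D <= exp (- K); the factor s / (1 + s) is at most 1. *)
  have e1 : s / (1 + s) * (n%:R * j%:R * delta / (64 * (C + 2) * ln D ^+ 2)) <=
      n%:R * D / (2 * K * - ln D).
    rewrite -[n%:R * j%:R * delta]mulrA -/D -sqrrN.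
    have q0 : 0 < (64 * (C + 2) * (- ln D) ^+ 2) by rewrite !mulr_gt0 ?exprn_gt0//; lra.
    apply: (@le_trans _ _ (n%:R * D / (64 * (C + 2) * (- ln D) ^+ 2))).
      rewrite ler_piMl ?divr_ge0 ?(ltW nD0) ?(ltW q0)//.
      by rewrite ler_pdivrMr; lra.
    have q1 : 0 < 2 * K * - ln D by rewrite !mulr_gt0//; lra.
    rewrite ler_wpM2l ?(ltW nD0)// lef_pV2 ?posrE//.
    move: La0 LaK; set La := - ln D => La0 LaK.
    have : K * La <= La ^+ 2 by rewrite expr2 ler_wpM2r// ltW.
    have : 0 <= C * La ^+ 2 by rewrite mulr_ge0// sqr_ge0.
    have : 0 <= La ^+ 2 by rewrite sqr_ge0.
    lra.
  have e2 : n%:R * - (D / (K * - ln D)) = - (2 * (n%:R * D / (2 * K * - ln D))).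
    have lD : ln D != 0 by rewrite lt_eqF// -oppr_gt0.
    have K0 : K != 0 by rewrite gt_eqF//; lra.
    by field; rewrite lD K0.
  have e3 : n%:R * delta / (2 * K * ln n%:R) <= n%:R * D / (2 * K * - ln D).
    apply: ler_pM.
    - by rewrite mulr_ge0// ltW.
    - by rewrite invr_ge0 !mulr_ge0 ?ltW//; lra.
    - by rewrite ler_wpM2l// ltW.
    - rewrite lef_pV2 ?posrE ?mulr_gt0//; try lra.
      by rewrite ler_wpM2l// mulr_ge0//; lra.
  rewrite e2; lra.
apply: (@likelihood_le_shell _ _ _ _ _ _ _ Tts _ n _ D alpha m _ a lam) => //.
- by move=> t /GE[].
- move=> t /GE[_ _ /andP[Dt tj]]; rewrite (ltW Dt)/= (le_trans tj)//.
- move=> t /GE[Tt _ /andP[_ tj]].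
  (* On the slice H <= 2 D <= 2 eps <= dbar / 2, which is where the bound dbar / 4 on eps comes
     from. *)
  apply: le_trans (A1 dbar _); last by rewrite dbar0 lexx.
  apply: ereal_sup_ubound; exists t => //.
  split => //; rewrite KLinf_next// add0e (le_trans tj)// lee_fin; lra.
- have -> : G j = F `&` (KL_set M ts ks.+1 (2 * j.+1%:R * delta)
          `\` KL_set M ts ks.+1 (2 * j%:R * delta)).
    by apply/seteqP; split => [t []|t].
  exact: ent.
- exact: ltW.
Qed.

End near_truth.

(** * Asymptotics *)

Section asymptotics.
Context {R : realType}.
Implicit Types n : nat.

Lemma ln_nat_ge (B : R) : exists N, forall n, (N <= n)%N -> (0 < n)%N /\ B <= ln n%:R.
Proof.
exists (Num.bound (expR B)) => n Nn.
have Bn : expR B < n%:R.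
  by rewrite (lt_le_trans (archi_boundP (expR_ge0 B)))// ler_nat.
have n0 : 0 < n%:R :> R by exact: lt_trans (expR_gt0 B) Bn.
by split; [rewrite -(ltr_nat R)|rewrite -[leLHS]expRK ler_ln ?posrE ?expR_gt0// ltW].
Qed.

Lemma gt0_powRE (x y : R) : 0 < x -> x `^ y = expR (y * ln x).
Proof. by move=> x0; rewrite /powR gt_eqF. Qed.

(** For n > 1 the bases n and ln n are positive, so thresholds and rates are compared through
    exponents that are linear in ln n and ln (ln n). *)
Lemma thresholdE (beta1 beta2 D2 : R) n : (1 < n)%N ->
  threshold beta1 beta2 D2 n = beta1 * expR (beta2 * ln (ln n%:R) + D2 / 2 * ln n%:R).
Proof.
move=> n1; rewrite /threshold !gt0_powRE ?ln_gt0 ?ltr1n ?ltr0n ?(ltnW n1)//.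
by rewrite -mulrA -expRD.
Qed.

Lemma rateE (beta2 D1 D2 : R) n : (1 < n)%N ->
  rate beta2 D1 D2 n =
  expR ((3 * D1 / 2 + beta2) * ln (ln n%:R) - (D1 - D2) / 2 * ln n%:R).
Proof.
move=> n1; rewrite /rate !gt0_powRE ?ln_gt0 ?ltr1n ?ltr0n ?(ltnW n1)//.
by rewrite expRB.
Qed.

(** [sup] is only meaningful on a bounded set, so an upper bound is needed besides a positive term;
    ln m <= m gives the former. *)
Lemma delta0_gt0 (beta1 beta2 D2 : R) n : 0 < beta1 -> 0 <= beta2 -> 0 < D2 -> (1 < n)%N ->
  0 < delta0 beta1 beta2 D2 n.
Proof.
move=> b1 b2 d2 n1; rewrite mulr_gt0// /max_log_threshold; set S := [set _ | _ in _].
have ln_thr m : (1 < m)%N -> ln (threshold beta1 beta2 D2 m) =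
    ln beta1 + (beta2 * ln (ln m%:R) + D2 / 2 * ln m%:R).
  by move=> m1; rewrite thresholdE// lnM ?posrE ?expR_gt0// expRK.
have ubS : has_ubound S.
  exists (`|ln beta1| + beta2 + D2 / 2) => _ [m /= nm <-].
  have m1 : (1 < m)%N by exact: leq_trans nm.
  have m0 : 0 < m%:R :> R by rewrite ltr0n ltnW.
  rewrite mulrC ler_pdivrMr// ln_thr//.
  have lm0 : 0 < ln m%:R :> R by rewrite ln_gt0// ltr1n.
  have lm : ln m%:R <= m%:R :> R by rewrite ltW// ln_sublinear.
  have llm : ln (ln m%:R) <= m%:R :> R by rewrite (le_trans _ lm)// ltW// ln_sublinear.
  have h1 : ln beta1 <= `|ln beta1| * m%:R.
    by rewrite (le_trans (ler_norm _))// ler_peMr// ler1n ltnW.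
  have h2 := ler_wpM2l b2 llm.
  have h3 : D2 / 2 * ln m%:R <= D2 / 2 * m%:R by rewrite ler_wpM2l// divr_ge0// ltW.
  by rewrite !mulrDl addrA; apply: lerD => //; exact: lerD.
(* The fraction makes D2 / 2 ln m exceed |ln beta1|, and the added 1 makes ln (ln m) nonnegative. *)
have [N NP] := ln_nat_ge (2 * (`|ln beta1| + 1) / D2 + 1).
pose m := maxn n N; have nm : (n <= m)%N by exact: leq_maxl.
have m1 : (1 < m)%N by exact: leq_trans nm.
have [_ lm] := NP m (leq_maxr _ _).
have m0 : 0 < m%:R :> R by rewrite ltr0n ltnW.
apply: (@lt_le_trans _ _ (m%:R^-1 * ln (threshold beta1 beta2 D2 m))); last first.
  by apply: ub_le_sup => //; exists m.
rewrite mulr_gt0 ?invr_gt0// ln_thr//.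
have q0 : 0 <= 2 * (`|ln beta1| + 1) / D2.
  by rewrite mulr_ge0 ?invr_ge0 ?(ltW d2)// mulr_ge0// addr_ge0.
have h1 : 0 <= beta2 * ln (ln m%:R) by rewrite mulr_ge0// ln_ge0//; lra.
have h2 : `|ln beta1| + 1 <= D2 / 2 * ln m%:R.
  have e : D2 / 2 * (2 * (`|ln beta1| + 1) / D2) = `|ln beta1| + 1.
    by field; rewrite gt_eqF.
  by rewrite -e ler_wpM2l ?divr_ge0 ?(ltW d2)//; lra.
have := ler_norm (- ln beta1); rewrite normrN; lra.
Qed.

(** The contribution of (O1). The logarithmic factor of the rate arises here, as (ln^3 n)^(D1/2)
    from [delta_n] times (ln n)^beta2 from the threshold. *)
Lemma threshold_mul_delta_n (beta1 beta2 D1 D2 delta1 : R) n : 0 < delta1 -> (1 < n)%N ->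
  threshold beta1 beta2 D2 n * delta_n delta1 n `^ (D1 / 2) =
  beta1 * delta1 `^ (D1 / 2) * rate beta2 D1 D2 n.
Proof.
move=> d1 n1; have n0 : 0 < n%:R :> R by rewrite ltr0n ltnW.
have l0 : 0 < ln n%:R :> R by rewrite ln_gt0// ltr1n.
have dn0 : 0 < delta_n delta1 n by rewrite !mulr_gt0 ?invr_gt0 ?exprn_gt0.
rewrite thresholdE// rateE// !gt0_powRE// -!mulrA -!expRD; congr (_ * expR _).
have -> : ln (delta_n delta1 n) = ln delta1 - ln n%:R + 3 * ln (ln n%:R).
  have l3 : ln (ln n%:R ^+ 3) = 3 * ln (ln n%:R) :> R by rewrite lnXn// mulr_natl.
  have q0 : 0 < ln n%:R ^+ 3 :> R by rewrite exprn_gt0.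
  move: l3 q0; rewrite /delta_n; set q := ln n%:R ^+ 3 => l3 q0.
  by rewrite lnM ?posrE ?mulr_gt0 ?invr_gt0// lnM ?posrE ?invr_gt0// lnV ?posrE// l3.
by field.
Qed.

(** The contribution of (O2): the same power of n as the rate, without the factor (ln n)^(3 D1/2),
    which is at least 1. *)
Lemma threshold_mul_powRN (beta1 beta2 D1 D2 : R) n : 0 < beta1 -> 0 < D1 -> (1 < n)%N ->
  1 <= ln n%:R :> R ->
  threshold beta1 beta2 D2 n * n%:R `^ (- (D1 / 2)) <= beta1 * rate beta2 D1 D2 n.
Proof.
move=> b1 d1 n1 l1; have n0 : 0 < n%:R :> R by rewrite ltr0n ltnW.
rewrite thresholdE// rateE// !gt0_powRE// -!mulrA -!expRD ler_wpM2l ?(ltW b1)//.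
rewrite ler_expR.
have : 0 <= D1 * ln (ln n%:R) by rewrite mulr_ge0 ?ln_ge0 ?(ltW d1).
lra.
Qed.

(** The exponent kappa ln^2 n outgrows (1 + D1/2) ln n, the cost of the factor n and of the powers
    of n in the threshold and the rate. *)
Lemma threshold_mul_expRN (beta1 beta2 D1 D2 kappa : R) :
  0 < beta1 -> 0 < D1 -> 0 < kappa ->
  exists B : R, forall n, (1 < n)%N -> 1 <= ln n%:R :> R -> B <= ln n%:R ->
    threshold beta1 beta2 D2 n * (n%:R * expR (- (kappa * ln n%:R ^+ 2))) <=
    beta1 * rate beta2 D1 D2 n.
Proof.
move=> b1 d1 k0; exists ((1 + D1 / 2) / kappa) => n n1 l1 lB.
have n0 : 0 < n%:R :> R by rewrite ltr0n ltnW.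
rewrite thresholdE// rateE// -[X in _ * (X * _)]lnK ?posrE//.
rewrite -!mulrA -!expRD ler_wpM2l ?(ltW b1)// ler_expR.
have h1 : 0 <= D1 * ln (ln n%:R) by rewrite mulr_ge0 ?ln_ge0 ?(ltW d1).
have h2 : (1 + D1 / 2) * ln n%:R <= kappa * ln n%:R ^+ 2.
  rewrite expr2 mulrA ler_wpM2r//; first lra.
  by move: lB; rewrite ler_pdivrMr// [kappa * _]mulrC.
lra.
Qed.

(** Weakens exp (- kappa n) to exp (- kappa ln^2 n / 2), so that [threshold_mul_expRN] also covers
    the part far from the truth. *)
Lemma sqr_ln_le n : (0 < n)%N -> ln n%:R ^+ 2 / 2 <= n%:R :> R.
Proof.
move=> n0; have l0 : 0 <= ln n%:R :> R by rewrite ln_ge0// ler1n.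
have := expR_ge1Dxn 1 l0; rewrite lnK ?posrE ?ltr0n//.
rewrite (_ : 2`!%:R = 2 :> R)//; lra.
Qed.

End asymptotics.

(** * Prior mass near the truth and the final bound *)

Section prior_mass.
Context d (Z : measurableType d) {R : realType} (mu : {measure set Z -> \bar R}).
Variables (M : model mu) (Pi : prior M) (ks : nat) (ts : 'rV[R]_(pdim M ks)).

(** (O1) is stated for decreasing sequences, but [delta_n] first increases with n, so the bound is
    extracted at a single value. *)
Lemma condO1_le k (C2 D1 x : R) : condO1 Pi ts k C2 D1 -> 0 < x ->
  (prior_k Pi k [set t | Theta M k t /\ (KL ts t <= x%:E)%E]
    <= (C2 * x `^ (D1 / 2))%:E)%E.
Proof.
move=> [_ _ h] x0.
(* The factor 2 makes the value x at index 1, the first index allowed in (O1). *)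
have := h (fun n => 2 * x * n.+1%:R^-1) _ _ 1%N.
have -> : 2 * x * 2%:R^-1 = x by field.
apply => //.
- move=> m n; rewrite ler_pM2l ?mulr_gt0// lef_pV2 ?posrE// ler_nat ltnS.
  by [].
- rewrite -[X in _ --> X](mulr0 (2 * x)); apply: cvgMr; exact: cvg_harmonic.
Qed.

End prior_mass.

Theorem theorem3 (d : measure_display) (Z : measurableType d) (R : realType)
    (mu : {measure set Z -> \bar R}) (M : model mu)
    (ks : nat) (ts : 'rV[R]_(pdim M ks)) (Pi : prior M)
    (alpha dbar m C2 C3 beta1 beta2 L D1 D2 : R)
    (F : nat -> set 'rV[R]_(pdim M ks.+1))
    (n0 : nat) (s delta1 : R) :
  is_order ts ->
  condA1 ts ->
  condA1_at ts ks.+1 alpha dbar m ->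
  condA2 ts ->
  condO1 Pi ts ks.+1 C2 D1 ->
  condO2 Pi F C3 D1 ->
  condO3 Pi ts beta1 beta2 L D1 D2 ->
  D2 < D1 ->
  is_n0 beta1 beta2 D2 n0 ->
  0 < s ->
  admissible_delta1 (C1_const alpha m) s D1 D2 n0 delta1 ->
  (forall n j : nat,
    (n0 <= n)%N ->
    delta_n delta1 n < delta0 beta1 beta2 D2 n0 ->
    (0 < j)%N ->
    j%:Z <= strict_floor (delta0 beta1 beta2 D2 n0 / delta_n delta1 n) ->
    (param_entropy ts
       (F n `&` (KL_set M ts ks.+1 (2 * j.+1%:R * delta_n delta1 n)
                 `\` KL_set M ts ks.+1 (2 * j%:R * delta_n delta1 n)))
       (j%:R * delta_n delta1 n / 4)
     <= (s / (1 + s)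
         * (n%:R * j%:R * delta_n delta1 n
            / (64 * (C1_const alpha m + 2)
               * ln (j%:R * delta_n delta1 n) ^+ 2)))%:E)%E) ->
  exists2 c3 : R, 0 < c3 &
    forall n : nat, (n0 <= n)%N ->
      (product_law (law M ts)
         [set zs : n.-tuple Z | (ks%:R%:E < order_est Pi zs)%E]
       <= (c3 * rate beta2 D1 D2 n)%:E)%E.
Proof.
move=> [[Tts _] _] _ A1at A2 O1 [C3p O2] [b1p Lp d2p b2p O3] D12 [[n00 _] _] s0 adm ent.
have [C2p D1p _] := O1; have [alp dbp m1 _] := A1at.
(* At n = 1 the rate vanishes; beyond it the rate is positive, so finitely many n can be absorbed
   into c3. *)
have n01 : (1 < n0)%N.
  move: n00 adm; case: n0 {ent} => [|[|]]// _.
  by rewrite /admissible_delta1 ln1 expr0n/= inve0 maxey.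
set C1 := C1_const alpha m in adm ent *.
have C10 : 0 <= C1.
  rewrite /C1 /C1_const divr_ge0//; first by rewrite mulr_ge0 ?addr_ge0 ?sqr_ge0.
  by rewrite mulr_ge0 ?sqr_ge0.
have d1p : 0 < delta1.
  rewrite -lte_fin; apply: lt_le_trans adm; rewrite !lt_max lte_fin.
  by apply/orP; left; apply/orP; left; rewrite !mulr_gt0//; lra.
have d0p : 0 < delta0 beta1 beta2 D2 n0 by exact: delta0_gt0.
have [K K1 rateK] := shell_rate alp m1.
(* The three bounds serve (A1), [shell_rate] and the range of j in the entropy condition; the last
   must be strict, hence the half. *)
pose eps := Num.min (Num.min (dbar / 4) (expR (- K))) (delta0 beta1 beta2 D2 n0 / 2).
have eps0 : 0 < eps by rewrite !lt_min expR_gt0 !divr_gt0.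
have epsd : eps <= dbar / 4 by rewrite !ge_min lexx.
have epsK : eps <= expR (- K) by rewrite !ge_min lexx ?orbT.
have epsd0 : eps < delta0 beta1 beta2 D2 n0.
  apply: (@le_lt_trans _ _ (delta0 beta1 beta2 D2 n0 / 2)); last by lra.
  by rewrite !ge_min lexx orbT.
have [C C0 [kappa kappa0 far]] := likelihood_le_far Tts ks.+1 A2 eps0.
pose kap1 := delta1 / (2 * K).
have kap10 : 0 < kap1 by rewrite divr_gt0// mulr_gt0//; lra.
have kap20 : 0 < kappa / 2 by rewrite divr_gt0.
have [B1 near1] := threshold_mul_expRN beta2 D2 b1p D1p kap10.
have [B2 far1] := threshold_mul_expRN beta2 D2 b1p D1p kap20.
(* [delta1^-1] ensures 1/n <= delta_n and [2 / (beta1 * D2)] ensures 3 t_n >= 1, that is c <= 1. *)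
pose B := Num.max (Num.max 1 (Num.max B1 B2)) (Num.max delta1^-1 (2 / (beta1 * D2))).
have [N0 NP] := ln_nat_ge B.
pose N := maxn N0 n0.
(* One term for each of (O3), (O1), (O2), the shells and the far part; each factor 3 comes from 1/c
   = 3 t_n. *)
pose C' := L + 3 * (C2 * (beta1 * delta1 `^ (D1 / 2))) + 3 * (C3 * beta1)
  + 3 * beta1 + 3 * (C * beta1).
have C'0 : 0 < C'.
  have h1 : 0 <= C2 * (beta1 * delta1 `^ (D1 / 2)).
    by rewrite mulr_ge0 ?(ltW C2p)// mulr_ge0 ?powR_ge0 ?(ltW b1p).
  have h2 : 0 <= C3 * beta1 by rewrite mulr_ge0 ?(ltW C3p) ?(ltW b1p).
  have h3 : 0 <= C * beta1 by rewrite mulr_ge0 ?(ltW b1p).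
  rewrite /C'; lra.
have rate_ge0 n : 0 <= rate beta2 D1 D2 n by rewrite /rate divr_ge0 ?powR_ge0.
(* For n < N the probability is bounded by 1, that is, by the rate times its inverse. *)
pose c3 := C' + \sum_(i < N) (rate beta2 D1 D2 i)^-1.
have C'c3 : C' <= c3 by rewrite lerDl sumr_ge0// => i _; rewrite invr_ge0.
exists c3; first exact: lt_le_trans C'c3.
move=> n n0n; have n1 : (1 < n)%N by exact: leq_trans n0n.
have rate0 : 0 < rate beta2 D1 D2 n by rewrite rateE// expR_gt0.
have [nN|Nn] := ltnP n N.
  apply: (@le_trans _ _ 1%E).
    by apply: probability_le1; exact: (measurable_order_est_gt Pi Tts).
  rewrite lee_fin -(@mulVf _ (rate beta2 D1 D2 n)) ?gt_eqF// ler_wpM2r ?(ltW rate0)//.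
  rewrite -[leLHS]add0r lerD ?(ltW C'0)// (bigD1 (Ordinal nN))//= lerDl.
  by rewrite sumr_ge0// => i _; rewrite invr_ge0.
have [_ Bn] := NP n (leq_trans (leq_maxl _ _) Nn).
have [l1 B1n B2n dn tn] : [/\ 1 <= ln n%:R :> R, B1 <= ln n%:R, B2 <= ln n%:R,
    delta1^-1 <= ln n%:R & 2 / (beta1 * D2) <= ln n%:R].
  by move: Bn; rewrite !ge_max => /andP[/andP[-> /andP[-> ->]] /andP[-> ->]].
have l0 : 0 < ln n%:R :> R by lra.
have nR0 : 0 < n%:R :> R by rewrite ltr0n ltnW.
set thr := threshold beta1 beta2 D2 n.
have thrp : 0 < thr by rewrite /thr thresholdE// mulr_gt0 ?expR_gt0.
have thr1 : 1 <= 3 * thr.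
  have h : 1 + D2 / 2 * ln n%:R <= expR (beta2 * ln (ln n%:R) + D2 / 2 * ln n%:R).
    apply: le_trans (expR_ge1Dx _); rewrite lerD2l lerDr.
    by rewrite mulr_ge0// ln_ge0.
  have := ler_wpM2l (ltW b1p) h; rewrite -thresholdE// -/thr => h'.
  have e : beta1 * D2 * (2 / (beta1 * D2)) = 2 by field; rewrite !gt_eqF.
  have := ler_wpM2l (ltW (mulr_gt0 b1p d2p)) tn; rewrite e; lra.
pose c := (3 * thr)^-1.
have c01 : 0 < c <= 1 by rewrite invr_gt0 mulr_gt0//= invf_le1// mulr_gt0.
have /andP[c0 _] := c01.
set delta := delta_n delta1 n.
have nd : n%:R * delta = delta1 * ln n%:R ^+ 3.
  by rewrite /delta /delta_n; field; rewrite gt_eqF.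
have delta_ge : n%:R^-1 <= delta.
  rewrite -[leLHS]mulr1 ler_pdivrMl// nd.
  have : 1 <= delta1 * ln n%:R by rewrite mulrC -ler_pdivrMr// mul1r.
  have : 1 <= ln n%:R ^+ 2 :> R by rewrite exprn_ege1.
  have -> : delta1 * ln n%:R ^+ 3 = (delta1 * ln n%:R) * ln n%:R ^+ 2 by ring.
  nra.
have delta0p : 0 < delta by apply: lt_le_trans delta_ge; rewrite invr_gt0.
have [mFn FnT piFn] := O2 n (ltnW n1).
have near : likelihood_le ts n
    (F n `&` [set t | (delta%:E < KL ts t <= eps%:E)%E]) c
    (n%:R * (c^-1 * expR (- (n%:R * delta / (2 * K * ln n%:R))))).
  apply: (@likelihood_le_near _ _ _ _ _ _ _ Tts n (F n) alpha dbar m K s C1) => //.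
    by rewrite ltr1n.
  move=> j j0 je.
  have j1 : 1 <= j%:R :> R by rewrite ler1n.
  have djd : j%:R * delta < delta0 beta1 beta2 D2 n0 by exact: le_lt_trans je epsd0.
  apply: ent => //.
    by apply: le_lt_trans djd; rewrite ler_peMl// ltW.
  (* j <= ceil x - 1 means j < ceil x, which follows from j < x. *)
  rewrite /strict_floor -ltzD1 subrK -(ltr_int R).
  rewrite -pmulrn; apply: (@lt_le_trans _ _ (delta0 beta1 beta2 D2 n0 / delta)).
    by rewrite ltr_pdivlMr.
  exact: ceil_ge.
have both : likelihood_le ts n (F n `&` [set t | (delta%:E < KL ts t)%E]) c
    (n%:R * (c^-1 * expR (- (n%:R * delta / (2 * K * ln n%:R)))) +
     C * (c^-1 * expR (- (kappa * n%:R)))).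
  apply: likelihood_leW (likelihood_leU near (far n c c01)) => // t [Ft /= dt].
  have [te|et] := leP (KL ts t) eps%:E; [left|right].
    by split => //=; apply/andP; split.
  by split => //; exact: FnT.
apply: (le_trans (order_est_gt_le Tts Pi mFn FnT c0 both)).
have c3E : 3 * c = thr^-1 by rewrite /c; field; rewrite gt_eqF.
have cVE : c^-1 = 3 * thr by rewrite /c invrK.
rewrite c3E cVE.
have h0 := O3 n (ltnW n1).
have h1 := condO1_le O1 delta0p.
apply: (@le_trans _ _ ((L * rate beta2 D1 D2 n)%:E +
    (3 * thr)%:E * (C2 * delta `^ (D1 / 2))%:E +
    (3 * thr)%:E * (C3 * n%:R `^ (- (D1 / 2)))%:E +
    (n%:R * (3 * thr * expR (- (n%:R * delta / (2 * K * ln n%:R)))) +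
     C * (3 * thr * expR (- (kappa * n%:R))))%:E)%E).
  have t30 : (0 <= (3 * thr)%:E)%E by rewrite lee_fin; lra.
  by apply: leeD => //; apply: leeD; [apply: leeD => //|]; exact: lee_wpmul2l.
rewrite -!EFinM -!EFinD lee_fin.
apply: (@le_trans _ _ (C' * rate beta2 D1 D2 n)); last by rewrite ler_wpM2r ?(ltW rate0).
have e1 := threshold_mul_delta_n beta1 beta2 D1 D2 d1p n1.
have e2 := threshold_mul_powRN beta2 D2 b1p D1p n1 l1.
have e3 := near1 n n1 l1 B1n.
have e4 := far1 n n1 l1 B2n.
move: e1 e2 e3 e4; rewrite -/thr -/delta => e1 e2 e3 e4.
have -> : n%:R * delta / (2 * K * ln n%:R) = kap1 * ln n%:R ^+ 2.
  by rewrite nd /kap1; field; rewrite !gt_eqF//; lra.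
have f4 : thr * expR (- (kappa * n%:R)) <= beta1 * rate beta2 D1 D2 n.
  apply: le_trans e4; rewrite ler_wpM2l ?(ltW thrp)//.
  apply: (@le_trans _ _ (expR (- (kappa / 2 * ln n%:R ^+ 2)))).
    rewrite ler_expR lerN2 mulrAC -mulrA ler_wpM2l ?(ltW kappa0)//.
    exact: sqr_ln_le (ltnW n1).
  by rewrite ler_peMl ?expR_ge0// ler1n ltnW.
have g1 : 3 * thr * (C2 * delta `^ (D1 / 2)) =
    3 * (C2 * (beta1 * delta1 `^ (D1 / 2))) * rate beta2 D1 D2 n.
  have -> : 3 * thr * (C2 * delta `^ (D1 / 2)) = 3 * C2 * (thr * delta `^ (D1 / 2)).
    by ring.
  by rewrite e1; ring.
have g2 := ler_wpM2l (ltW C3p) e2.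
have g4 := ler_wpM2l C0 f4.
rewrite g1 /C'; lra.
Qed.
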